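(* Let $X$ be a metrizable space. The following are equivalent: (1) $X$ is a coronated ANR; (2) $X$ admits a resolution of the form $\dots\to X_2\to X_1$, where the image of each $X_i$ in each $X_j$ ($i\ge j$) under the bonding map is an ANR; (3) $X$ admits a sequential resolution $\dots\to X_2\to X_1$ in which every $X_i$ is an ANR and whose bonding maps are embeddings.
   Context: All spaces are metrizable; ANR means absolute neighborhood retract for metrizable spaces. A coronated ANR is a metrizable space $X$ containing a compact subset $K$ such that $X\setminus K$ is an ANR. A sequential resolution of a metrizable space $X$ is an inverse sequence $\dots\to X_2\to X_1$ of metrizable spaces with continuous bonding maps $p^m_n\colon X_m\to X_n$ ($m\ge n$, $p^n_n=\mathrm{id}$), with inverse limit $X$ and projections $p^\infty_n\colon X\to X_n$, such that: (B1) for each $n$ and every neighborhood $U$ of $p^\infty_n(X)$ in $X_n$ there is $m\ge n$ with $p^m_n(X_m)\subset U$; (B2) for every open cover $C$ of $X$ there are an $n$ and an open cover $D$ of $X_n$ such that $(p^\infty_n)^{-1}(D)$ refines $C$. *)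

(* Defs.v *)
From mathcomp Require Import all_boot.
From mathcomp Require Import all_classical all_reals topology.

Set Implicit Arguments.
Unset Strict Implicit.
Unset Printing Implicit Defensive.

Local Open Scope classical_set_scope.

Definition homeomorphism (X Y : topologicalType) (f : X -> Y) : Prop :=
  continuous f /\
  exists g : Y -> X, [/\ continuous g, cancel f g & cancel g f].

(* The image is the type [set_type (range f)] with the subspace topology (the
   topology of [subspace (range f)] is a different one, on all of Y). *)
Definition embedding (X Y : topologicalType) (f : X -> Y) : Prop :=
  exists2 h : X -> range f, homeomorphism h & forall x, \val (h x) = f x.

Definition metrizable (R : realType) (X : topologicalType) : Prop :=
  exists (M : metricType R) (f : X -> M), homeomorphism f.

(* The retraction is defined on the type of points of U only, because X may be
   empty while Y is not. *)
Definition ANR (R : realType) (X : topologicalType) : Prop :=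
  metrizable R X /\
  forall (Y : topologicalType) (f : X -> Y),
    metrizable R Y -> embedding f -> closed (range f) ->
    exists2 U : set Y, set_nbhs (range f) U &
    exists2 r : U -> X, continuous r &
      forall (u : U) (x : X), \val u = f x -> r u = x.

Definition coronated_ANR (R : realType) (X : topologicalType) : Prop :=
  metrizable R X /\
  exists2 K : set X, compact K & ANR R (~` K : Type).

(* Stages are numbered from 0; [bond] is the whole system p^m_n, m >= n. *)
Record inverse_sequence := InverseSequence {
  stage :> nat -> topologicalType;
  bond : forall m n : nat, (n <= m)%N -> stage m -> stage n;
  bond_continuous : forall (m n : nat) (le_nm : (n <= m)%N),
    continuous (bond le_nm);
  bond_id : forall (n : nat) (le_nn : (n <= n)%N) (x : stage n),
    bond le_nn x = x;
  bond_comp : forall (m n k : nat) (le_nm : (n <= m)%N) (le_kn : (k <= n)%N)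
      (x : stage m),
    bond le_kn (bond le_nm x) = bond (leq_trans le_kn le_nm) x
}.

Definition threads (S : inverse_sequence) : set (prod_topology (fun n : nat => S n)) :=
  [set x | forall (m n : nat) (le_nm : (n <= m)%N), bond le_nm (x m) = x n].
Arguments threads : clear implicits.

Definition is_inverse_limit (S : inverse_sequence) (X : topologicalType)
    (q : forall n : nat, X -> S n) : Prop :=
  exists2 h : X -> threads S, homeomorphism h &
    forall (x : X) (n : nat), (\val (h x)) n = q n x.

Definition open_cover (X : topologicalType) (C : set (set X)) : Prop :=
  C `<=` open /\ \bigcup_(U in C) U = setT.

Definition refines (X : Type) (C D : set (set X)) : Prop :=
  forall U, C U -> exists2 V, D V & U `<=` V.

Record is_resolution (R : realType) (S : inverse_sequence)
    (X : topologicalType) (q : forall n : nat, X -> S n) : Prop := {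
  resolution_metrizable : forall n : nat, metrizable R (S n);
  resolution_limit : is_inverse_limit q;
  resolution_B1 : forall (n : nat) (U : set (S n)),
    set_nbhs (range (q n)) U ->
    exists (m : nat) (le_nm : (n <= m)%N), range (@bond S m n le_nm) `<=` U;
  resolution_B2 : forall C : set (set X), open_cover C ->
    exists (n : nat) (D : set (set (S n))),
      open_cover D /\ refines [set q n @^-1` V | V in D] C
}.

(* Main.v *)
(* Everything metrizable embeds in a "cube", the space of [0,1]-valued
   functions on a set with the sup metric, and cubes are absolute extensors by
   Hausdorff's explicit extension formula.  Hence a metrizable space is an ANR iff
   it is an ANE, and Hanner's theorem holds: a countable union of open ANEs is an
   ANE (glue two open sets along a level set of a difference of distances; for an
   increasing union use even and odd annuli).

   Given a resolution with ANR images, let O be the set of points near which some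
   stage n determines the topology of X and q_n(X) coincides with the image of some
   later stage.  O is a countable union of open ANEs.  Its complement K is compact:
   a sequence of K without cluster points would contradict (B1), or else have
   nearby points that no stage resolves, which contradicts (B2).

   Conversely, let K be compact with X \ K an ANR.  In the product of a cube
   with the open cone over X \ K, where X sits as the graph of "distance to K",
   take X together with all points at distance < c from K and with a tube around
   X \ K whose radius decreases to 0 as the distance to K grows to 2c.  This is
   a union of two open ANEs, and as c -> 0 the intersection is X. *)
Require Import Defs.
From HB Require Import structures.
From mathcomp Require Import all_boot all_order all_algebra.
From mathcomp Require Import all_classical all_reals topology.
From mathcomp Require Import ring lra.

Set Implicit Arguments.
Unset Strict Implicit.
Unset Printing Implicit Defensive.

Import Order.TTheory GRing.Theory Num.Theory.
Import numFieldTopology.Exports metricType_numDomainType.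

Local Open Scope classical_set_scope.

(** * Cubes and truncated distances *)

(** In the second construction the obstacle is that [X] need not be an ANR at the points of [K], so
    no neighborhood retraction onto [X] is available; only [X \ K] has one. A stage must therefore
    be an ANE near [K] for a reason that does not involve [X] there, and away from [K] for one that
    does. Near [K] it is an open piece of the product of a cube with the cone. Farther out the
    center is extended by the ANE property of [X \ K], and the cube component is pushed towards it.
    In the first construction two things can spoil a point at a given stage: the stage induces too
    coarse a topology, or images of later stages exceed that of [X]. Along a sequence of [K] without
    cluster points, (B1) shows that the second cannot occur without the first nearby; (B2) then
    excludes the first. *)

Ltac case_real := repeat match goal with
  | |- context [@Order.max _ _ ?a ?b] => case: (lerP a b)
  | |- context [@Order.min _ _ ?a ?b] => case: (lerP a b)
  | |- context [@Num.norm _ _ ?a] => case: (ger0P a)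
  end.

Section Cube.
Local Open Scope ring_scope.
Variable R : realType.

(** The inserted 0 keeps the set nonempty. For a family bounded above this is the supremum of the
    positive parts, and it is 0 for the empty family. *)
Definition bsup (I : Type) (A : set I) (F : I -> R) : R :=
  sup ([set 0] `|` F @` A).

Lemma bsup_le (I : Type) (A : set I) (F : I -> R) (c : R) :
  0 <= c -> (forall a, A a -> F a <= c) -> bsup A F <= c.
Proof.
move=> c0 Fc; apply: ge_sup; first by exists 0; left.
by move=> _ [->//|[a Aa <-]]; exact: Fc.
Qed.

Lemma bsup_ge0 (I : Type) (A : set I) (F : I -> R) (b : R) :
  (forall a, A a -> F a <= b) -> 0 <= bsup A F.
Proof.
move=> Fb; apply: ub_le_sup; last by left.
exists (Num.max 0 b) => _ [->|[a Aa <-]]; first by rewrite le_max lexx.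
by rewrite le_max Fb// orbT.
Qed.

Lemma bsup_ge (I : Type) (A : set I) (F : I -> R) (b : R) a :
  (forall a, A a -> F a <= b) -> A a -> F a <= bsup A F.
Proof.
move=> Fb Aa; apply: ub_le_sup; last by right; exists a.
exists (Num.max 0 b) => _ [->|[a' Aa' <-]]; first by rewrite le_max lexx.
by rewrite le_max Fb// orbT.
Qed.

Lemma bsup_gtP (I : Type) (A : set I) (F : I -> R) (c : R) :
  0 <= c -> c < bsup A F -> exists2 a, A a & c < F a.
Proof.
move=> c0 cF; apply: contrapT => /forall2NP H.
move: cF; rewrite ltNge => /negP; apply; apply: bsup_le => // a Aa.
by have [//|] := H a; rewrite leNgt => /negP.
Qed.

Lemma bsup_lip (I : Type) (A : set I) (F G : I -> R) (b e : R) : 0 <= e ->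
  (forall a, A a -> F a <= b) -> (forall a, A a -> G a <= b) ->
  (forall a, A a -> `|F a - G a| <= e) -> `|bsup A F - bsup A G| <= e.
Proof.
move=> e0 Fb Gb FG; rewrite ler_norml; apply/andP; split.
- rewrite lerBrDr addrC lerBlDr; apply: bsup_le => [|a Aa].
    by rewrite addr_ge0// (bsup_ge0 Fb).
  have := FG _ Aa; rewrite ler_norml => /andP[+ _].
  have := bsup_ge Fb Aa; lra.
- rewrite lerBlDr; apply: bsup_le => [|a Aa].
    by rewrite addr_ge0// (bsup_ge0 Gb).
  have := FG _ Aa; rewrite ler_norml => /andP[_ +].
  have := bsup_ge Gb Aa; lra.
Qed.

Definition clip (x : R) : R := Num.max 0 (Num.min 1 x).

Lemma clip_itv x : 0 <= clip x <= 1.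
Proof. by rewrite /clip le_max lexx/= ge_max ler01 ge_min lexx. Qed.

Lemma clip_id x : 0 <= x <= 1 -> clip x = x.
Proof. by case/andP=> x0 x1; rewrite /clip (min_idPr x1) (max_idPr x0). Qed.

Lemma clip_lip x y : `|clip x - clip y| <= `|x - y|.
Proof. rewrite /clip; case_real => *; lra. Qed.

Definition cube (S : Type) : Type := {f : S -> R | forall s, 0 <= f s <= 1}.

Definition cube_val S (u : cube S) : S -> R := sval u.
Coercion cube_val : cube >-> Funclass.

Lemma cube_itv S (u : cube S) s : 0 <= u s <= 1.
Proof. exact: (svalP u s). Qed.

Lemma cube_ge0 S (u : cube S) s : 0 <= u s.
Proof. by have /andP[] := cube_itv u s. Qed.

Lemma cube_le1 S (u : cube S) s : u s <= 1.
Proof. by have /andP[] := cube_itv u s. Qed.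

Lemma cubeP S (u v : cube S) : (forall s, u s = v s) -> u = v.
Proof.
case: u v => [u hu] [v hv] /= uv.
have {}uv : u = v by apply/funext.
by subst v; congr exist; exact: Prop_irrelevance.
Qed.

(** Clipping removes any side condition on [f]; continuity does not suffer, as [clip] is
    1-Lipschitz. *)
Definition cube_of S (f : S -> R) : cube S :=
  @exist (S -> R) (fun g => forall s, 0 <= g s <= 1) (clip \o f)
    (fun s => clip_itv (f s)).

Lemma cube_ofE S (f : S -> R) s : cube_of f s = clip (f s).
Proof. by []. Qed.

HB.instance Definition _ S := gen_eqMixin (cube S).
HB.instance Definition _ S := gen_choiceMixin (cube S).

Definition cdist S (u v : cube S) : R := bsup setT (fun s => `|u s - v s|).

Lemma cdist_bound S (u v : cube S) s : setT s -> `|u s - v s| <= 1.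
Proof.
move=> _; rewrite ler_norml.
have /andP[] := cube_itv u s; have /andP[] := cube_itv v s; lra.
Qed.

Lemma cdist_le S (u v : cube S) c : 0 <= c ->
  (forall s, `|u s - v s| <= c) -> cdist u v <= c.
Proof. by move=> c0 uv; apply: bsup_le => // s _. Qed.

Lemma cdist_ge S (u v : cube S) s : `|u s - v s| <= cdist u v.
Proof. exact: bsup_ge (@cdist_bound _ u v) I. Qed.

Lemma cdist_ge0 S (u v : cube S) : 0 <= cdist u v.
Proof. exact: bsup_ge0 (@cdist_bound _ u v). Qed.

Let cdistxx S (u : cube S) : cdist u u = 0.
Proof.
by apply/eqP; rewrite eq_le cdist_ge0 andbT; apply: cdist_le => // s; rewrite subrr normr0.
Qed.

Let cdist_eq0 S (u v : cube S) : cdist u v = 0 -> u = v.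
Proof.
move=> uv; apply: cubeP => s; apply/eqP; rewrite -subr_eq0 -normr_le0 -uv.
exact: cdist_ge.
Qed.

Let cdist_sym S (u v : cube S) : cdist u v = cdist v u.
Proof.
by apply/eqP; rewrite eq_le !cdist_le ?cdist_ge0// => s; rewrite distrC cdist_ge.
Qed.

Let cdist_triangle S (v u w : cube S) : cdist u w <= cdist u v + cdist v w.
Proof.
apply: cdist_le => [|s]; first by rewrite addr_ge0 ?cdist_ge0.
by rewrite (le_trans (ler_distD (v s) _ _))// lerD// cdist_ge.
Qed.

HB.instance Definition _ S := @isMetric.Build R (cube S) (@cdist S) (@cdistxx S)
  (@cdist_eq0 S) (@cdist_sym S) (@cdist_triangle S).

Lemma cube_dist_le S (u v : cube S) c : 0 <= c ->
  (forall s, `|u s - v s| <= c) -> mdist u v <= c.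
Proof. exact: cdist_le. Qed.

Lemma cube_dist_ge S (u v : cube S) s : `|u s - v s| <= mdist u v.
Proof. exact: cdist_ge. Qed.

End Cube.

Section Dist1.
Local Open Scope ring_scope.
Context {R : realType} {Y : metricType R}.
Implicit Types (A B : set Y) (x y a : Y).

(* The distance to a set, cut off at 1; it is 1 when the set is empty. *)
Definition dist1 A y : R := 1 - bsup A (fun a => 1 - mdist y a).

Let bound y A : forall a, A a -> 1 - mdist y a <= 1.
Proof. by move=> a _; rewrite lerBlDr lerDl mdist_ge0. Qed.

Lemma dist1_ge0 A y : 0 <= dist1 A y.
Proof. by rewrite subr_ge0; apply: bsup_le => //; exact: bound. Qed.

Lemma dist1_le1 A y : dist1 A y <= 1.
Proof. by rewrite lerBlDr lerDl; apply: bsup_ge0 (@bound y A). Qed.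

Lemma dist1_le A y a : A a -> dist1 A y <= mdist y a.
Proof. by move=> Aa; rewrite lerBlDr -lerBlDl; apply: bsup_ge (@bound y A) Aa. Qed.

Lemma dist1_in A a : A a -> dist1 A a = 0.
Proof.
move=> Aa; apply/eqP; rewrite eq_le dist1_ge0 andbT -(mdistxx a).
exact: dist1_le.
Qed.

Lemma dist1_ltP A y c : c <= 1 -> dist1 A y < c -> exists2 a, A a & mdist y a < c.
Proof.
move=> c1; rewrite ltrBlDr -ltrBlDl => /bsup_gtP[|a Aa h]; first lra.
by exists a => //; lra.
Qed.

Lemma dist1_lip A x y : `|dist1 A x - dist1 A y| <= mdist x y.
Proof.
rewrite /dist1 opprB addrC addrA subrK.
apply: (@bsup_lip _ _ _ _ _ 1) => [|||a _].
- exact: mdist_ge0.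
- exact: bound.
- exact: bound.
- rewrite ler_norml.
  have := metric_triangle x y a; have := metric_triangle y x a.
  by rewrite (metric_sym y x) => *; apply/andP; split; lra.
Qed.

Lemma dist1_sub A B y : A `<=` B -> dist1 B y <= dist1 A y.
Proof.
move=> AB; rewrite lerD2l lerN2; apply: bsup_le; first exact: bsup_ge0 (@bound y B).
by move=> a /AB Ba; apply: bsup_ge (@bound y B) Ba.
Qed.

Lemma dist1_gt0P A y : 0 < dist1 A y <-> ~ closure A y.
Proof.
split=> [d0 cA|ncA].
- have [a [Aa]] := cA _ (nbhsx_ballx y _ d0).
  by rewrite ballEmdist/= ltNge dist1_le.
- rewrite lt_neqAle dist1_ge0 andbT; apply/eqP => d0; apply: ncA => U.
  rewrite -filter_from_mdist_nbhs => -[e e0 eU].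
  have [||a Aa ya] := @dist1_ltP A y (Num.min 1 e).
  + by rewrite ge_min lexx.
  + by rewrite -d0 lt_min ltr01.
  + by exists a; split => //; apply: eU; rewrite (lt_le_trans ya)// ge_min lexx orbT.
Qed.

End Dist1.

(** * Hausdorff's extension formula *)

Section Within.
Context {Y Z : topologicalType}.
Implicit Types (A B : set Y) (f g : Y -> Z).

Lemma withinP A f : {within A, continuous f} <->
  forall a, A a -> forall N, nbhs (f a) N -> nbhs a [set y | A y -> N (f y)].
Proof. by rewrite subspace_continuousP. Qed.

Lemma within_eq A f g : (forall a, A a -> f a = g a) ->
  {within A, continuous f} -> {within A, continuous g}.
Proof.
move=> fg /withinP cf; apply/withinP => a Aa N; rewrite -fg// => /(cf a Aa).
by apply: filterS => y /= H Ay; rewrite -fg//; exact: H.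
Qed.

Lemma within_sub A B f : A `<=` B ->
  {within B, continuous f} -> {within A, continuous f}.
Proof. exact: continuous_subspaceW. Qed.

Lemma within_local A f :
  (forall a, A a -> exists2 N, nbhs a N & {within A `&` N, continuous f}) ->
  {within A, continuous f}.
Proof.
move=> H; apply/withinP => a Aa M fM; have [N aN /withinP cf] := H a Aa.
have := cf a (conj Aa (nbhs_singleton aN)) M fM; apply: filterS2 aN => y Ny.
by move=> + Ay; apply.
Qed.

Lemma open_within_preimage A f (B : set Z) : open A ->
  {within A, continuous f} -> open B -> open (A `&` f @^-1` B).
Proof.
move=> oA /withinP cf oB; rewrite openE => a [Aa Ba].
have := cf a Aa B (open_nbhs_nbhs (conj oB Ba)).
by apply: filterS2 (open_nbhs_nbhs (conj oA Aa)) => y Ay H; split=> //; exact: H.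
Qed.

End Within.

Lemma within_comp (X Y Z : topologicalType) (A : set X) (B : set Y)
    (f : X -> Y) (g : Y -> Z) : {within A, continuous f} ->
  {within B, continuous g} -> (forall a, A a -> B (f a)) ->
  {within A, continuous (g \o f)}.
Proof.
move=> /withinP cf /withinP cg fAB; apply/withinP => a Aa N gN.
have := cf a Aa _ (cg _ (fAB _ Aa) _ gN).
by apply: filterS => y H Ay; apply: H => //; exact: fAB.
Qed.

Section WithinMetric.
Local Open Scope ring_scope.
Context {R : realType}.

Lemma nbhs_mdist (M : metricType R) (x : M) (N : set M) :
  nbhs x N <-> exists2 e, 0 < e & forall y, mdist x y < e -> N y.
Proof. by rewrite -filter_from_mdist_nbhs. Qed.

Lemma near_mdist (M : metricType R) (x : M) (e : R) : 0 < e ->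
  nbhs x [set y | mdist x y < e].
Proof. by move=> e0; apply/nbhs_mdist; exists e. Qed.

Lemma within_mdistP (Y : topologicalType) (M : metricType R) (A : set Y)
    (f : Y -> M) : {within A, continuous f} <->
  forall a, A a -> forall e, 0 < e -> nbhs a [set y | A y -> mdist (f a) (f y) < e].
Proof.
rewrite withinP; split=> H a Aa => [e e0|N /nbhs_mdist[e e0 eN]].
  exact: (H a Aa _ (near_mdist (f a) e0)).
by apply: filterS (H a Aa e e0) => y /= + Ay => /(_ Ay); exact: eN.
Qed.

Lemma within_realP (Y : topologicalType) (A : set Y) (f : Y -> R) :
  {within A, continuous f} <->
  forall a, A a -> forall e, 0 < e -> nbhs a [set y | A y -> `|f a - f y| < e].
Proof.
rewrite withinP; split=> H a Aa => [e e0|N /nbhs_ballP[e /= e0 eN]].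
  exact: (H a Aa _ (nbhsx_ballx (f a) e e0)).
by apply: filterS (H a Aa e e0) => y /= + Ay => /(_ Ay); exact: eN.
Qed.

Lemma within_cubeP (Y : topologicalType) S (A : set Y) (f : Y -> cube R S) :
  {within A, continuous f} <->
  forall a, A a -> forall e, 0 < e ->
    nbhs a [set y | A y -> forall s, `|f a s - f y s| <= e].
Proof.
rewrite within_mdistP; split=> H a Aa e e0.
  apply: filterS (H a Aa e e0) => y /= + Ay s => /(_ Ay) /ltW.
  exact/le_trans/cube_dist_ge.
apply: filterS (H a Aa (e / 2) _) => [y /= + Ay|]; last by rewrite divr_gt0.
move=> /(_ Ay) h; rewrite (@le_lt_trans _ _ (e / 2))//; last lra.
by apply: cube_dist_le => //; lra.
Qed.

Lemma open_real_gt (Y : topologicalType) (A : set Y) (f g : Y -> R) : open A ->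
  {within A, continuous f} -> {within A, continuous g} ->
  open (A `&` [set y | f y < g y]).
Proof.
move=> oA /within_realP cf /within_realP cg; rewrite openE => a [Aa fg].
have e0 : 0 < (g a - f a) / 2 by move: fg => /=; lra.
apply: filterS3 (open_nbhs_nbhs (conj oA Aa)) (cf a Aa _ e0) (cg a Aa _ e0).
move=> y Ay /(_ Ay) hf /(_ Ay) hg; split=> //=; move: hf hg.
by rewrite !ltr_norml => /andP[? ?] /andP[? ?]; lra.
Qed.

End WithinMetric.

Section HausdorffExtension.
Local Open Scope ring_scope.
Context {R : realType} {Y : metricType R} {S : Type}.
Variables (O A : set Y) (f : Y -> cube R S).
Hypothesis clA : closure A `&` O `<=` A.
Hypothesis cf : {within A, continuous f}.

Let D := dist1 A.
(** The weight is 0 at points of [A] at distance at least [2 * D y] from [y], and nearly [D y] at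
    nearly nearest points when [D y < 1]. So [N y s / D y] is a weighted supremum of values of [f]
    at points of [A] close to [y]. *)
Let w y a := Num.max 0 (2 * D y - mdist y a).
Let N y s := bsup A (fun a => f a s * w y a).

Let w_ge0 y a : 0 <= w y a. Proof. by rewrite /w le_max lexx. Qed.

Let w_le y a : A a -> w y a <= D y.
Proof.
by move=> Aa; rewrite /w ge_max dist1_ge0/=; have := dist1_le y Aa; rewrite -/D; lra.
Qed.

Let fw_le y s a : A a -> f a s * w y a <= D y.
Proof.
move=> Aa; rewrite -[leRHS]mul1r; apply: ler_pM; rewrite ?cube_ge0 ?cube_le1//.
exact: w_le.
Qed.

Let N_ge0 y s : 0 <= N y s.
Proof. exact: bsup_ge0 (@fw_le y s). Qed.

Let N_le y s : N y s <= D y.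
Proof. by apply: bsup_le (@fw_le y s); exact: dist1_ge0. Qed.

Let w_lip x y a : `|w x a - w y a| <= 3 * mdist x y.
Proof.
have := dist1_lip A x y; rewrite -/D.
have := metric_triangle x y a; have := metric_triangle y x a.
by rewrite (metric_sym y x) /w; case_real => *; lra.
Qed.

Let N_lip x y s : `|N x s - N y s| <= 3 * mdist x y.
Proof.
apply: (@bsup_lip _ _ _ _ _ 1) => [|a Aa|a Aa|a Aa].
- by rewrite mulr_ge0 ?mdist_ge0//; lra.
- by rewrite (le_trans (fw_le _ _ Aa)) ?dist1_le1.
- by rewrite (le_trans (fw_le _ _ Aa)) ?dist1_le1.
- rewrite -mulrBr normrM ger0_norm ?cube_ge0// -[leRHS]mul1r.
  by rewrite ler_pM ?cube_ge0 ?cube_le1.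
Qed.

Let F y : cube R S := if D y == 0 then f y else cube_of (fun s => N y s / D y).

(** [N] is 3-Lipschitz, [D] is 1-Lipschitz and [N y s <= D y], so the quotient moves by at most
    [4 * mdist y0 y / D y0]. This gives the second radius below; the first keeps [D y] positive. *)
Let F_off y0 : 0 < D y0 -> forall e, 0 < e ->
  nbhs y0 [set y | O y -> forall s, `|F y0 s - F y s| <= e].
Proof.
move=> D0 e e0; apply/nbhs_mdist.
exists (Num.min (D y0 / 2) (e * D y0 / 4)).
  by rewrite lt_min !divr_gt0 ?mulr_gt0//; lra.
move=> y; rewrite lt_min => /andP[h1 h2] _ s.
have := dist1_lip A y0 y; rewrite -/D => hD.
have D'0 : 0 < D y by move: hD; rewrite ler_norml => /andP[? ?]; lra.
rewrite /F !gt_eqF//= (le_trans (clip_lip _ _))//.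
have -> : N y0 s / D y0 - N y s / D y =
    ((N y0 s - N y s) * D y + N y s * (D y - D y0)) / (D y0 * D y).
  by field; rewrite !gt_eqF.
rewrite normrM normfV (gtr0_norm (mulr_gt0 D0 D'0)) ler_pdivrMr ?mulr_gt0//.
rewrite (le_trans (ler_normD _ _))// !normrM (gtr0_norm D'0) (ger0_norm (N_ge0 _ _)).
rewrite distrC in hD.
have h3 := ler_wpM2r (ltW D'0) (N_lip y0 y s).
have h4 : N y s * `|D y - D y0| <= D y * mdist y0 y.
  by rewrite ler_pM.
have h5 : 4 * mdist y0 y * D y <= e * D y0 * D y.
  by apply: ler_wpM2r; [exact: ltW|lra].
lra.
Qed.

Let F_on y0 : A y0 -> forall e, 0 < e ->
  nbhs y0 [set y | O y -> forall s, `|F y0 s - F y s| <= e].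
Proof.
move=> Ay0 e e0.
have /within_cubeP/(_ y0 Ay0 (e / 2)) := cf.
rewrite divr_gt0// => /(_ isT)/nbhs_mdist[r r0 hr]; apply/nbhs_mdist.
(* Points of [A] with positive weight lie within [2 * D y] of [y], hence within [3 * mdist y0 y] of
   [y0]. The bound 1 forces [D y < 1], below the cut-off of [dist1]. *)
exists (Num.min (r / 3) 1); first by rewrite lt_min ltr01 andbT divr_gt0.
move=> y; rewrite lt_min => /andP[h1 h2] Oy s.
rewrite {1}/F {1}/D dist1_in// eqxx /F.
case: eqP => [D0|/eqP D0].
  have Ay : A y.
    apply: clA; split => //; apply: contrapT => /dist1_gt0P.
    by rewrite -/D D0 ltxx.
  rewrite (le_trans (hr y _ Ay s))//; lra.
have {}D0 : 0 < D y by rewrite lt_neqAle eq_sym D0 dist1_ge0.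
rewrite -(clip_id (cube_itv (f y0) s)) (le_trans (clip_lip _ _))//.
have hD : D y <= mdist y0 y by rewrite metric_sym; exact: dist1_le.
have near a : A a -> mdist y a < 2 * D y -> `|f y0 s - f a s| <= e / 2.
  by move=> Aa ya; apply: hr => //; have := metric_triangle y0 y a; lra.
have up : N y s <= (f y0 s + e / 2) * D y.
  have f0 := cube_ge0 (f y0) s.
  apply: bsup_le => [|a Aa]; first by rewrite mulr_ge0 ?dist1_ge0 //; lra.
  have [ya|ya] := ltP (mdist y a) (2 * D y).
    apply: ler_pM; rewrite ?cube_ge0 ?w_le//.
    by have := near a Aa ya; rewrite ler_norml => /andP[? ?]; lra.
  rewrite /w (max_idPl _) ?mulr0; last lra.
  by rewrite mulr_ge0 ?dist1_ge0 //; lra.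
have lo : (f y0 s - e) * D y <= N y s.
  have [h|h] := leP (f y0 s) e.
    by rewrite (le_trans _ (N_ge0 _ _))// mulr_le0_ge0 ?subr_le0// ltW.
  have e1 : e <= 1 by rewrite (le_trans (ltW h)) ?cube_le1.
  (* A nearly nearest point of [A] has weight at least [D y * (1 - e / 2)], which suffices for the
     lower bound. As [e <= 1], it is also closer than [2 * D y], so [f] there is within [e / 2] of
     [f y0]. *)
  pose c := Num.min 1 (D y * (1 + e / 2)).
  have [||a Aa ya] := @dist1_ltP _ _ A y c.
  - by rewrite /c ge_min lexx.
  - rewrite -/D lt_min (le_lt_trans hD)//=.
    by rewrite -[X in X < _]mulr1 ltr_pM2l//; lra.
  - have {}ya : mdist y a < D y * (1 + e / 2).
      by rewrite (lt_le_trans ya)// ge_min lexx orbT.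
    have ya2 : D y * (1 + e / 2) <= 2 * D y.
      by rewrite mulrC ler_pM2r//; lra.
    have : f a s * w y a <= N y s by exact: bsup_ge (@fw_le y s) Aa.
    apply: le_trans.
    have hw : D y * (1 - e / 2) <= w y a.
      by rewrite /w le_max; apply/orP; right; lra.
    have ha := near a Aa (lt_le_trans ya ya2).
    have hfa : f y0 s - e / 2 <= f a s.
      by move: ha; rewrite ler_norml => /andP[? ?]; lra.
    apply: (@le_trans _ _ ((f y0 s - e / 2) * (D y * (1 - e / 2)))).
      have f1 := cube_le1 (f y0) s.
      have : 0 <= D y * (e / 2 * (1 - f y0 s) + e * e / 4).
        by rewrite mulr_ge0 ?(ltW D0)// addr_ge0 ?divr_ge0 ?mulr_ge0//; lra.
      lra.
    by apply: ler_pM => //; [lra|rewrite mulr_ge0 ?dist1_ge0//; lra].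
have {}up : N y s / D y <= f y0 s + e / 2 by rewrite ler_pdivrMr.
have {}lo : f y0 s - e <= N y s / D y by rewrite ler_pdivlMr.
rewrite ler_norml; lra.
Qed.

Lemma cube_extension : exists2 g : Y -> cube R S,
  {within O, continuous g} & forall a, A a -> g a = f a.
Proof.
exists F => [|a Aa]; last by rewrite /F /D dist1_in// eqxx.
apply/within_cubeP => y Oy.
have [Ay|nAy] := pselect (A y); first exact: F_on.
by apply: F_off; apply/dist1_gt0P => cy; apply: nAy; apply: clA.
Qed.

End HausdorffExtension.

(** * Embeddings and metrizability *)

Section Embeds.

(** The neighborhood form of [embedding], which avoids the subtype on the image; [embedding_embeds]
    and [embeds_embedding] convert between the two. *)
Definition embeds (X C : topologicalType) (j : X -> C) : Prop :=
  injective j /\ forall x N, nbhs x N <->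
    exists2 V, nbhs (j x) V & forall x', V (j x') -> N x'.

Lemma embeds_continuous (X C : topologicalType) (j : X -> C) :
  embeds j -> continuous j.
Proof. by case=> _ je x V jV; apply/je; exists V. Qed.

Lemma embeds_comp (X Y C : topologicalType) (j : X -> Y) (k : Y -> C) :
  embeds j -> embeds k -> embeds (k \o j).
Proof.
move=> [ji je] [ki ke]; split; first exact: inj_comp.
move=> x N; split=> [/je[V /ke[W kW WV] VN]|[W kW WN]].
  by exists W => // x' /WV /VN.
apply/je; exists (k @^-1` W) => //; apply/ke; by exists W.
Qed.

Lemma embeds_lift (X Y C : topologicalType) (j : X -> C) (f : Y -> X) :
  embeds j -> continuous (j \o f) -> continuous f.
Proof.
move=> [_ je] cf y N /je[V jV VN].
exact: (filterS (fun y' => VN (f y')) (cf y V jV)).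
Qed.

Lemma continuous_prod_topology (Y : topologicalType) (K : nat -> topologicalType)
    (f : forall n, Y -> K n) : (forall n, continuous (f n)) ->
  continuous (fun y => (f ^~ y) : prod_topology K).
Proof.
move=> cf y; apply/cvg_sup => n U [_ [[V oV <-] Vy] VU].
exact: (filterS (fun y' => VU (f ^~ y')) (cf n y V (open_nbhs_nbhs (conj oV Vy)))).
Qed.

Lemma embeds_val (C : topologicalType) (A : set C) : embeds (\val : A -> C).
Proof.
split=> [x y|x N]; first exact: val_inj.
split=> [[_ [[W oW <-] Wx WN]]|[V xV VN]].
  exists W; first exact: open_nbhs_nbhs.
  by move=> x' Wx'; apply: WN; rewrite set_valE.
move: xV; rewrite nbhsE => -[W [oW Wx] WV].
exists (\val @^-1` W); split => //=; first by exists W => //; rewrite set_valE.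
by move=> x' /WV; exact: VN.
Qed.

Lemma range_val (T : Type) (A : set T) : range (\val : A -> T) = A.
Proof.
apply/seteqP; split=> [_ [y _ <-]|y Ay]; first exact: (set_mem (valP y)).
by exists (exist (fun y => y \in A) y (mem_set Ay)).
Qed.

Lemma homeomorphism_embeds (X Y : topologicalType) (f : X -> Y) :
  homeomorphism f -> embeds f.
Proof.
move=> [cf [g [cg fK gK]]]; split; first exact: can_inj fK.
move=> x N; split=> [xN|[V fV VN]]; last exact: (filterS VN (cf x V fV)).
exists (g @^-1` N); last by move=> x' /=; rewrite fK.
by apply: cg; rewrite fK.
Qed.

Lemma embedding_embeds (X Y : topologicalType) (f : X -> Y) :
  embedding f -> embeds f.
Proof.
move=> [h /homeomorphism_embeds hh hf].
have -> : f = \val \o h by exact/esym/funext.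
exact: (embeds_comp hh (@embeds_val _ _)).
Qed.

Lemma embeds_embedding (X Y : topologicalType) (f : X -> Y) :
  embeds f -> embedding f.
Proof.
move=> [fi fe].
pose h x : range f := exist _ (f x) (mem_set (ex_intro2 _ _ x I erefl)).
have gP (y : range f) : exists x, f x = \val y.
  by have /set_mem[x _ fx] := valP y; exists x.
exists h => //; split.
  move=> x N /((@embeds_val _ _).2 _ _) [V hV VN]; apply/fe; exists V => //.
  by move=> x' Vx'; exact: VN.
exists (fun y => sval (cid (gP y))); split.
- move=> y N; case: cid => x /= fxy /fe[V fV VN].
  apply/((@embeds_val _ _).2 _ _); exists V; first by move: fV; rewrite fxy.
  by move=> y' Vy'; apply: VN; case: cid => x' /= ->.
- by move=> x; case: cid => x' /= /fi.
- by move=> y; apply: val_inj => /=; case: cid.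
Qed.

Lemma embeds_within_inverse (X C Y : topologicalType) (j : X -> C) (A : set Y)
    (f : Y -> X) : embeds j -> {within A, continuous (j \o f)} ->
  {within A, continuous f}.
Proof.
move=> [ji je] /withinP cf; apply/withinP => a Aa N /je[V fV VN].
by apply: filterS (cf a Aa V fV) => y /= + Ay => /(_ Ay); exact: VN.
Qed.

Lemma continuous_withinT (Y Z : topologicalType) (A : set Y) (f : Y -> Z) :
  continuous f -> {within A, continuous f}.
Proof. by move=> cf; exact: continuous_subspaceT. Qed.

Lemma embeds_set (X C : topologicalType) (P : set X) (j : X -> C) :
  embeds j -> embeds (j \o \val : P -> C).
Proof. by move=> je; exact: embeds_comp (@embeds_val _ _) je. Qed.

Lemma embeds_inverse (X C : topologicalType) (j : X -> C) (x0 : X) :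
  embeds j -> exists2 g : C -> X, {within range j, continuous g} & cancel j g.
Proof.
move=> je; have [ji _] := je.
pose g c := if pselect (exists x, j x = c) is left h then sval (cid h) else x0.
have jK : cancel j g.
  move=> x; rewrite /g; case: pselect => [h|[]]; last by exists x.
  by case: cid => x' /= /ji.
exists g => //; apply: (embeds_within_inverse je).
apply: (@within_eq _ _ _ id) => [_ [x _ <-]|]; first by rewrite /= jK.
by apply: continuous_withinT => x; exact: cvg_id.
Qed.

End Embeds.

Section Metrizable.
Local Open Scope ring_scope.
Variable R : realType.

(** An alias of [X], so that the induced metric does not clash with a topology that [X] already
    carries. *)
Definition pullback_metric (X : choiceType) (M : metricType R) (j : X -> M)
  (ji : injective j) : Type := X.

Section Pullback.
Context (X : choiceType) (M : metricType R) (j : X -> M) (ji : injective j).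
Local Notation PX := (pullback_metric ji).

Let d (x y : PX) : R := mdist (j x) (j y).

Let dxx x : d x x = 0. Proof. exact: mdistxx. Qed.
Let d_eq0 x y : d x y = 0 -> x = y. Proof. by move=> /mdist_positivity/ji. Qed.
Let d_sym x y : d x y = d y x. Proof. exact: metric_sym. Qed.
Let d_triangle y x z : d x z <= d x y + d y z. Proof. exact: metric_triangle. Qed.

HB.instance Definition _ := Choice.on PX.
HB.instance Definition _ := isMetric.Build R PX dxx d_eq0 d_sym d_triangle.
End Pullback.

Lemma metrizableP (X : topologicalType) :
  metrizable R X <-> exists (M : metricType R) (j : X -> M), embeds j.
Proof.
split=> [[M [f /homeomorphism_embeds fe]]|[M [j [ji je]]]]; first by exists M, f.
pose PX : metricType R := pullback_metric ji.
pose f : X -> PX := id.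
have fN x N : nbhs x N <-> nbhs (f x) N.
  rewrite je nbhs_mdist; split=> [[V /nbhs_mdist[e e0 eV] VN]|[e e0 eN]].
    by exists e => // y jy; apply: VN; exact: eV.
  exists [set z | mdist (j x) z < e]; first exact: near_mdist.
  by move=> x' h; exact: eN.
exists PX, f; split; first by move=> x N /fN.
by exists id; split=> // x N /fN.
Qed.

Lemma embeds_metrizable (X Y : topologicalType) (j : X -> Y) :
  embeds j -> metrizable R Y -> metrizable R X.
Proof.
move=> je /metrizableP[M [k ke]]; apply/metrizableP.
by exists M, (k \o j); exact: embeds_comp.
Qed.

(** Kuratowski's map sends [x] to its distance function, clipped at 1. The triangle inequality makes
    it 1-Lipschitz, and evaluation at the second point gives back the clipped distance. *)
Lemma kuratowski (X : topologicalType) : metrizable R X ->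
  exists e : X -> cube R X, embeds e.
Proof.
move=> /metrizableP[M [h [hi he]]].
pose e x : cube R X := cube_of (fun s => mdist (h x) (h s)).
have e_le x x' : mdist (e x) (e x') <= mdist (h x) (h x').
  apply: cube_dist_le => [|s]; first exact: mdist_ge0.
  rewrite (le_trans (clip_lip _ _))// ler_norml.
  have := metric_triangle (h x) (h x') (h s).
  have := metric_triangle (h x') (h x) (h s).
  by rewrite (metric_sym (h x') (h x)) => *; apply/andP; split; lra.
have e_ge x x' c : c <= 1 -> mdist (e x) (e x') < c -> mdist (h x) (h x') < c.
  move=> c1 ec; have := le_lt_trans (cube_dist_ge (e x) (e x') x') ec.
  rewrite /= mdistxx /clip; have := mdist_ge0 (h x) (h x').
  by case_real => *; lra.
exists e; split=> [x x' exx'|x N].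
  apply: hi; apply/eqP; rewrite -[_ == _]negbK -mdist_gt0 -leNgt.
  apply/ler_addgt0Pl => c c0; rewrite addr0.
  apply: (@le_trans _ _ (Num.min c 1)); last by rewrite ge_min lexx.
  apply/ltW/e_ge; first by rewrite ge_min lexx orbT.
  by rewrite exx' mdistxx lt_min c0 ltr01.
rewrite he; split=> [[V /nbhs_mdist[c c0 cV] VN]|[V /nbhs_mdist[c c0 cV] VN]].
  exists [set z | mdist (e x) z < Num.min c 1].
    by apply: near_mdist; rewrite lt_min c0 ltr01.
  move=> x' /= h1; apply: VN; apply: cV.
  rewrite (lt_le_trans (e_ge _ _ _ _ h1)) ?ge_min ?lexx ?orbT//.
exists [set z | mdist (h x) z < c]; first exact: near_mdist.
by move=> x' /= h1; apply: VN; apply: cV; rewrite (le_lt_trans (e_le _ _)).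
Qed.

(** The extra coordinate will hold a distance: to the domain [A] in [ANR_ANE], to the compact set
    [K] in [coronated_resolution]. *)
Definition consc S (t : R) (u : cube R S) : cube R (option S) :=
  cube_of (fun o => if o is Some s then u s else t).

Lemma consc_Some S t (u : cube R S) s : consc t u (Some s) = u s.
Proof. by rewrite /= clip_id// cube_itv. Qed.

Lemma consc_None S t (u : cube R S) : 0 <= t <= 1 -> consc t u None = t.
Proof. exact: clip_id. Qed.

Lemma within_consc S (Y : topologicalType) (A : set Y) (t : Y -> R)
    (u : Y -> cube R S) : {within A, continuous t} -> {within A, continuous u} ->
  {within A, continuous (fun y => consc (t y) (u y))}.
Proof.
move=> /within_realP ct /within_cubeP cu; apply/within_cubeP => a Aa e e0.
apply: filterS2 (ct a Aa e e0) (cu a Aa e e0) => y ht hu Ay [s|].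
  by rewrite !consc_Some hu.
by rewrite (le_trans (clip_lip _ _))// ltW// ht.
Qed.

Lemma within_dist1 (Y : metricType R) (A B : set Y) :
  {within A, continuous (dist1 B)}.
Proof.
apply/within_realP => a _ e e0; apply: filterS (near_mdist a e0) => y /= h _.
exact: le_lt_trans (dist1_lip _ _ _) h.
Qed.

Lemma within_coord S (A : set (cube R S)) s :
  {within A, continuous (fun u : cube R S => u s)}.
Proof.
apply/within_realP => a _ e e0; apply: filterS (near_mdist a e0) => y /= h _.
exact: le_lt_trans (cube_dist_ge _ _ _) h.
Qed.

End Metrizable.

(** * Absolute neighborhood extensors *)

Section ANE.
Variable R : realType.

(* Maps are total, with values in an ambient space C, and are defined on subsets
   A that are relatively closed in an open set O: this way the domain of an
   extension problem can be shrunk without passing to subtypes. *)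
Definition ANE (C : topologicalType) (P : set C) : Prop :=
  forall (Y : metricType R) (O A : set Y) (f : Y -> C),
    open O -> A `<=` O -> closure A `&` O `<=` A ->
    {within A, continuous f} -> (forall a, A a -> P (f a)) ->
    exists U g, [/\ open U, A `<=` U /\ U `<=` O, {within U, continuous g},
      forall y, U y -> P (g y) & forall a, A a -> g a = f a].

Lemma ANE0 (C : topologicalType) : ANE (set0 : set C).
Proof.
move=> Y O A f oO AO clA cf fA; exists set0, f; split => //.
- exact: open0.
- by split=> // a /fA.
- by apply: within_sub cf.
Qed.

Lemma ANE_setI_open (C : topologicalType) (P G : set C) :
  open G -> ANE P -> ANE (P `&` G).
Proof.
move=> oG aP Y O A f oO AO clA cf fA.
have [|U [g [oU [AU UO] cg gP gf]]] := aP Y O A f oO AO clA cf.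
  by move=> a /fA[].
exists (U `&` g @^-1` G), g; split => //.
- exact: open_within_preimage.
- split=> [a Aa|y [Uy _]]; last exact: UO.
  by split; [exact: AU|rewrite /= gf//; have [] := fA a Aa].
- by apply: within_sub cg => y [].
- by move=> y [Uy Gy]; split => //; exact: gP.
Qed.

(** Applied to homeomorphisms, this also makes the property independent of the ambient space. *)
Lemma ANE_retract (C C' : topologicalType) (P : set C) (P' : set C')
    (i : C -> C') (r : C' -> C) :
  {within P, continuous i} -> (forall x, P x -> P' (i x)) ->
  {within P', continuous r} -> (forall x, P' x -> P (r x)) ->
  (forall x, P x -> r (i x) = x) -> ANE P' -> ANE P.
Proof.
move=> ci iP cr rP ri aP' Y O A f oO AO clA cf fA.
have [||U [g [oU AUO cg gP gf]]] := aP' Y O A (i \o f) oO AO clA.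
- exact: within_comp ci _.
- by move=> a /fA/iP.
exists U, (r \o g); split => //.
- exact: within_comp cr _.
- by move=> y /gP/rP.
- by move=> a Aa; rewrite /= gf//= ri//; exact: fA.
Qed.

(** The image of [X] in its cube need not be closed, so the ANR property does not apply to it
    directly. Placed at height 0 under the open upper half of a cube with one more coordinate, [X]
    is closed in the union [Z], and a neighborhood retraction exists. *)
Lemma ANR_ANE (X C : topologicalType) (j : X -> C) :
  ANR R X -> embeds j -> ANE (range j).
Proof.
move=> [mX aX] je; have [ji _] := je.
have [x0|X0] := pselect (exists x : X, True); last first.
  have -> : range j = set0.
    by rewrite -subset0 => c [x _ _]; apply: X0; exists x.
  exact: ANE0.
have {x0}[x0 _] := x0.
suff aT : ANE [set: X].
  have [g cg jK] := embeds_inverse x0 je.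
  apply: (@ANE_retract _ _ (range j) [set: X] g j _ _ _ _ _ aT) => //.
  - by apply: continuous_withinT; exact: embeds_continuous.
  - by move=> _ [x _ <-]; rewrite jK.
have [e ee] := kuratowski mX; have [ei _] := ee.
pose i x := consc 0%R (e x) : cube R (option X).
have i0 x : i x None = 0%R by rewrite consc_None// lexx ler01.
pose Z := [set z : cube R (option X) | (0 < z None)%R \/ exists x, z = i x].
pose k x : Z := exist _ (i x) (mem_set (or_intror (ex_intro _ x erefl))).
have ii : injective i.
  move=> x x' xx'; apply: ei; apply: cubeP => s.
  rewrite -(consc_Some 0%R (e x)) -(consc_Some 0%R (e x')).
  exact: (congr1 (fun u : cube R (option X) => u (Some s)) xx').
have di x x' : mdist (i x) (i x') = mdist (e x) (e x').
  apply/eqP; rewrite eq_le; apply/andP; split.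
    apply: cube_dist_le => [|[s|]]; first exact: mdist_ge0.
      by rewrite !consc_Some; exact: cube_dist_ge.
    by rewrite !i0 subrr normr0 mdist_ge0.
  apply: cube_dist_le => [|s]; first exact: mdist_ge0.
  rewrite -(consc_Some 0%R (e x)) -(consc_Some 0%R (e x')).
  exact: cube_dist_ge.
have ie : embeds i.
  split=> // x N; rewrite ee.2; split=> -[V /nbhs_mdist[c c0 cV] VN].
    exists [set z | (mdist (i x) z < c)%R]; first exact: near_mdist.
    by move=> x' /=; rewrite di => /cV /VN.
  exists [set z | (mdist (e x) z < c)%R]; first exact: near_mdist.
  by move=> x' /=; rewrite -di => /cV /VN.
have ke : embeds k.
  split=> [x x' /(congr1 val)/= /ii//|x N]; rewrite ie.2.
  split=> [[V iV VN]|[V kV VN]].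
    by exists (\val @^-1` V) => //; apply: (embeds_continuous (@embeds_val _ _)).
  have [W kW WV] := ((@embeds_val _ Z).2 _ _).1 kV.
  by exists W => // x' Wx'; apply: VN; exact: WV.
have mZ : metrizable R Z.
  apply/metrizableP; exists (cube R (option X)), \val; exact: embeds_val.
have cl : closed (range k).
  have -> : range k = \val @^-1` [set z : cube R (option X) | z None = 0%R].
    apply/seteqP; split=> [_ [x _ <-]|z /= z0]; first exact: i0.
    have /set_mem[|[x zx]] := valP z; first by rewrite z0 ltxx.
    by exists x => //; exact: val_inj.
  apply: closed_comp => [z _|].
    exact: (embeds_continuous (@embeds_val _ _)).
  have -> : [set z : cube R (option X) | z None = 0%R] =
      ~` (setT `&` [set z | (0 < z None)%R]).
    apply/seteqP; split=> [z /= z0 [_]|z /= z0]; first by rewrite z0 ltxx.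
    by apply/eqP; rewrite eq_le cube_ge0 andbT leNgt; apply/negP => z1; apply: z0; split.
  apply: open_closedC; apply: open_real_gt; first exact: openT.
    by apply: continuous_withinT; exact: cst_continuous.
  exact: within_coord.
have [U kU [r cr rk]] := aX Z k mZ (embeds_embedding ke) cl.
move=> Y O A f oO AO clA cf _.
have [G cG GA] : exists2 g : Y -> cube R X, {within O, continuous g} &
    forall a, A a -> g a = e (f a).
  apply: (cube_extension clA).
  apply: (@within_comp _ _ _ A setT f e) => //.
  by apply: continuous_withinT; exact: embeds_continuous.
(* With the distance to [A] as height, [F] maps [O] into [Z]: height 0 occurs only on [A], where [F]
   takes values in [X]. *)
pose F y := consc (dist1 A y) (G y).
have cF : {within O, continuous F} by apply: within_consc => //; exact: within_dist1.
have FA a : A a -> F a = i (f a) by move=> Aa; rewrite /F dist1_in// GA.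
(* [U] lives on the subtype [Z]; [W] is the open set of the cube formed by the points having a
   neighborhood whose trace on [Z] lies in [U]. *)
pose W := [set z | exists2 V, open_nbhs z V & forall u : Z, V (\val u) -> U u].
have oW : open W.
  rewrite openE => z [V [oV Vz] VU]; apply: filterS (open_nbhs_nbhs (conj oV Vz)).
  by move=> z' Vz'; exists V.
pose D := O `&` F @^-1` W.
have uP y : D y -> exists u : U, \val (\val u) = F y.
  move=> [Oy [V [oV VF] VU]].
  have Zy : F y \in Z.
    apply/mem_set; have [Ay|nAy] := pselect (A y); first by right; exists (f y); exact: FA.
    left; rewrite consc_None ?dist1_ge0 ?dist1_le1//; apply/dist1_gt0P => cy.
    by apply: nAy; exact: clA.
  have Uy : exist (fun z => z \in Z) (F y) Zy \in U by apply/mem_set; exact: VU.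
  by exists (exist (fun u => u \in U) _ Uy).
pose g y := if pselect (D y) is left h then r (sval (cid (uP y h))) else f y.
exists D, g; split => //.
- exact: open_within_preimage.
- split=> [a Aa|y []//]; split; first exact: AO.
  have := kU (k (f a)) (ex_intro2 _ _ _ I erefl).
  move=> /((@embeds_val _ _).2 _ _)[V]; rewrite nbhsE => -[V' oV' V'V] VU.
  by exists V'; [rewrite FA|move=> u /V'V /VU].
- apply/withinP => y Dy N; rewrite {1}/g; case: pselect => // h.
  case: cid => u /= uF ruN.
  have [V uV VN] := ((@embeds_val _ _).2 _ _).1 (cr u _ ruN).
  have [V' uV' VN'] := ((@embeds_val _ _).2 _ _).1 uV.
  have /withinP := cF => /(_ y h.1 V'); rewrite -uF => /(_ uV').
  apply: filterS => y' + Dy'; rewrite /g; case: pselect => // h'.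
  case: cid => u' /= u'F; rewrite -u'F => /(_ h'.1) V'u'.
  by apply: VN; exact: VN'.
- move=> a Aa; rewrite /g; case: pselect => // h; case: cid => u /= uF.
  apply: rk; apply: val_inj => /=; rewrite -FA//.
Qed.

(** The retraction is an extension of the inverse of [f] from its closed image; [h] carries the
    problem to a metric space. *)
Lemma ANE_ANR (X C : topologicalType) (j : X -> C) :
  metrizable R X -> embeds j -> ANE (range j) -> ANR R X.
Proof.
move=> mX je aj; split => // Y f mY fe fcl; have [ji _] := je.
have [x0|X0] := pselect (exists x : X, True); last first.
  exists set0 => [y [x _ _]|]; first by case: X0; exists x.
  have H (u : (set0 : set Y)) : False by have /set_mem := valP u.
  exists (fun u => False_rect X (H u)) => [u|u]; by case: (H u).
have {x0}[x0 _] := x0.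
have [M [h hh]] := mY; have he := homeomorphism_embeds hh.
have hfe : embeds (h \o f) := embeds_comp (embedding_embeds fe) he.
have [f' cf' f'K] := embeds_inverse x0 hfe.
have hfcl : closed (range (h \o f)).
  have [ch [h' [ch' hK h'K]]] := hh.
  have -> : range (h \o f) = h' @^-1` range f.
    apply/seteqP; split=> [_ [x _ <-]|m [x _ fx]]; first by exists x => //=; rewrite hK.
    by exists x => //=; rewrite fx h'K.
  by apply: closed_comp fcl => m _; exact: ch'.
have [|||||U [g [oU [AU _] cg gj gf]]] :=
    aj M setT (range (h \o f)) (j \o f').
- exact: openT.
- by [].
- by rewrite setIT -((closure_id _).1 hfcl).
- apply: (@within_comp _ _ _ (range (h \o f)) setT f' j) => //.
  by apply: continuous_withinT; exact: embeds_continuous.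
- by move=> m _; exists (f' m).
have rP (u : (h @^-1` U)) : exists x, j x = g (h (\val u)).
  have /set_mem/= /gj[x _ jx] := valP u; by exists x.
exists (h @^-1` U) => [_ [x _ <-]|].
  apply: (embeds_continuous he); apply: open_nbhs_nbhs; split => //.
  by apply: AU; exists x.
exists (fun u => sval (cid (rP u))) => [u N|u x ux].
  case: cid => x /= jx /(je.2 _ _).1[V jV VN].
  have /withinP cgU := cg.
  have /set_mem/= Uu := valP u.
  have := cgU _ Uu V; rewrite -jx => /(_ jV) /(embeds_continuous he) uW.
  apply/((@embeds_val _ _).2 _ _); exists (h @^-1` [set m | U m -> V (g m)]) => //.
  move=> u' Vu'; apply: VN; case: cid => x' /= ->.
  by apply: Vu'; exact: (set_mem (valP u')).
case: cid => x' /= jx'; apply: ji; rewrite jx' ux gf.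
  by rewrite /= -[h (f x)]/((h \o f) x) f'K.
by exists x.
Qed.

Lemma ANE_set_ANR (C : topologicalType) (A : set C) :
  metrizable R C -> ANE A -> ANR R (A : Type).
Proof.
move=> mC aA; apply: (ANE_ANR (embeds_metrizable (@embeds_val _ _) mC) (@embeds_val _ _)).
by rewrite range_val.
Qed.

Lemma ANR_ANE_set (C : topologicalType) (A : set C) : ANR R (A : Type) -> ANE A.
Proof. by move=> aA; rewrite -(range_val A); exact: ANR_ANE aA (@embeds_val _ _). Qed.

End ANE.

(** * Hanner's theorem *)

Section Gluing.

(** The closure hypotheses say that [P] and [Q] are relatively closed in their union. *)
Lemma within_setU (Y Z : topologicalType) (P Q : set Y) (f : Y -> Z) :
  closure P `&` Q `<=` P -> closure Q `&` P `<=` Q ->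
  {within P, continuous f} -> {within Q, continuous f} ->
  {within P `|` Q, continuous f}.
Proof.
move=> cPQ cQP /withinP cP /withinP cQ; apply/withinP => a PQa N fN.
have side (S : set Y) : (forall a, S a -> forall N, nbhs (f a) N ->
      nbhs a [set y | S y -> N (f y)]) ->
    (closure S a -> S a) -> nbhs a [set y | S y -> N (f y)].
  move=> cS clS; have [Sa|nSa] := pselect (S a); first exact: cS.
  have : ~ closure S a by move/clS.
  rewrite -[~ _]/((~` closure S) a) -interiorC; apply: filterS => y nSy /nSy[].
have hP : closure P a -> P a by case: PQa => // Qa cPa; exact: cPQ.
have hQ : closure Q a -> Q a by case: PQa => // Pa cQa; exact: cQP.
apply: filterS2 (side P cP hP) (side Q cQ hQ) => y yP yQ [Py|Qy].
  exact: yP.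
exact: yQ.
Qed.

End Gluing.

Section Hanner.
Local Open Scope ring_scope.
Variable R : realType.

Lemma within_dist1B (Y : metricType R) (A B D : set Y) :
  {within D, continuous (fun y => dist1 A y - dist1 B y)}.
Proof.
apply/within_realP => a _ e e0.
have e2 : 0 < e / 2 by rewrite divr_gt0.
apply: filterS (near_mdist a e2) => y /= h _.
have := dist1_lip A a y; have := dist1_lip B a y.
rewrite !ler_norml ltr_norml => /andP[? ?] /andP[? ?]; lra.
Qed.

Lemma closure_le (Y : topologicalType) (s t : Y -> R) (D : set Y) :
  {within setT, continuous s} -> {within setT, continuous t} ->
  (forall y, D y -> s y <= t y) -> forall y, closure D y -> s y <= t y.
Proof.
move=> cs ct Dst y cy; rewrite leNgt; apply/negP => ts.
have [|z [Dz [_ /=]]] := cy (setT `&` [set z | t z < s z]).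
  by apply: open_nbhs_nbhs; split=> //; apply: open_real_gt => //; exact: openT.
by rewrite ltNge Dst.
Qed.

(** First extend [f] over the level set [s = 0] with values in both [G1] and [G2]. Each side is then
    extended together with this common piece, so that the two results agree on the level set and can
    be pasted. *)
Lemma ANE_union2 (C : topologicalType) (W G1 G2 : set C) :
  open G1 -> open G2 -> W `<=` G1 `|` G2 ->
  ANE R (W `&` G1) -> ANE R (W `&` G2) -> ANE R W.
Proof.
move=> oG1 oG2 WG aG1 aG2 Y O A f oO AO clA cf fA.
(* If [f a] misses [G], then [a] is at distance 0 from the points mapped outside [G], but at
   positive distance from those mapped outside [G']. *)
have sep (G G' : set C) : open G' -> W `<=` G `|` G' -> forall a, A a ->
    dist1 (A `\` f @^-1` G') a <= dist1 (A `\` f @^-1` G) a -> G (f a).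
  move=> oG' WGG' a Aa d_le; apply: contrapT => nGa.
  have da : dist1 (A `\` f @^-1` G) a = 0 by apply: dist1_in; split.
  have G'a : G' (f a) by case: (WGG' _ (fA _ Aa)).
  have /dist1_gt0P : ~ closure (A `\` f @^-1` G') a.
    have /withinP/(_ a Aa G') := cf => /(_ (open_nbhs_nbhs (conj oG' G'a))) aG'.
    by move=> /(_ _ aG')[y [[Ay nG'y] /(_ Ay)]].
  by rewrite ltNge (le_trans d_le)// da.
pose s y := dist1 (A `\` f @^-1` G2) y - dist1 (A `\` f @^-1` G1) y.
have cs D : {within D, continuous s} by exact: within_dist1B.
have c0 (D : set Y) : {within D, continuous (fun=> 0 : R)}.
  by apply: continuous_withinT; exact: cst_continuous.
have s1 a : A a -> s a <= 0 -> G1 (f a).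
  by move=> Aa; rewrite /s subr_le0; exact: sep.
have s2 a : A a -> 0 <= s a -> G2 (f a).
  by move=> Aa; rewrite /s subr_ge0; apply: sep => // w /WG[]; [right|left].
have cl_le D : (forall y, D y -> s y <= 0) -> forall y, closure D y -> s y <= 0.
  exact: closure_le.
have cl_ge D : (forall y, D y -> 0 <= s y) -> forall y, closure D y -> 0 <= s y.
  exact: closure_le.
pose A0 := A `&` [set y | s y = 0].
have [||||U0 [g0 [oU0 [AU0 UO0] cg0 g0P g0f]]] :=
    ANE_setI_open oG2 aG1 (f := f) oO (A := A0).
- by move=> y [/AO].
- move=> y [cy Oy]; split.
    by apply: clA; split => //; apply: closure_subset cy => z [].
  apply/eqP; rewrite eq_le; apply/andP; split.
    by apply: cl_le cy => z [_ /= ->].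
  by apply: cl_ge cy => z [_ /= ->].
- by apply: within_sub cf => y [].
- move=> a [Aa /= sa]; split; [split|]; first exact: fA.
    by apply: s1 => //; rewrite sa.
  by apply: s2 => //; rewrite sa.
(* Points with [s = 0] are kept only inside [U0], so [g0] is available on the whole level set of
   [O']. *)
pose O' := U0 `|` (O `&` [set y | s y < 0] `|` O `&` [set y | 0 < s y]).
have oO' : open O'.
  by apply: openU => //; apply: openU; exact: open_real_gt.
have O'O : O' `<=` O by move=> y [/UO0|[[]|[]]].
have AO' : A `<=` O'.
  move=> a Aa; have [sa|sa|sa] := ltgtP (s a) 0.
  - by right; left; split => //; exact: AO.
  - by right; right; split => //; exact: AO.
  - by left; apply: AU0.
have O'0 y : O' y -> s y = 0 -> U0 y.
  by move=> [//|[[_ /=]|[_ /=]]] + s0; rewrite s0 ltxx.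
pose f1 y := if s y == 0 then g0 y else f y.
have f1A a : A a -> f1 a = f a.
  by move=> Aa; rewrite /f1; case: eqP => // sa; apply: g0f.
have half (D : set Y) (G : set C) : ANE R (W `&` G) ->
    (forall y, closure (A `&` D) y -> D y) -> (forall y, s y = 0 -> D y) ->
    (forall a, A a -> D a -> G (f a)) -> (W `&` G1 `&` G2 `<=` W `&` G) ->
    exists U g, [/\ open U, U `<=` O', {within U, continuous g},
      forall y, U y -> (W `&` G) (g y) &
      forall y, (A `&` D) y \/ (O' y /\ s y = 0) -> U y /\ g y = f1 y].
  move=> aG clD D0 GD GW.
  pose B := (A `&` D) `|` (O' `&` [set y | s y = 0]).
  have clAD y : closure (A `&` D) y -> O y -> (A `&` D) y.
    move=> cy Oy; split; last exact: clD.
    by apply: clA; split => //; apply: closure_subset cy => z [].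
  have cl0 y : closure (O' `&` [set y | s y = 0]) y -> s y = 0.
    move=> cy; apply/eqP; rewrite eq_le; apply/andP; split.
      by apply: cl_le cy => z [_ /= ->].
    by apply: cl_ge cy => z [_ /= ->].
  have [||||U [g [oU [BU UO'] cg gW gf]]] := aG Y O' B f1 oO'.
  - by move=> y [[/AO']|[]].
  - move=> y [+ O'y]; rewrite closureU => -[cy|cy].
      by left; apply: clAD => //; exact: O'O.
    by right; split => //; exact: cl0.
  - apply: within_setU.
    + by move=> y [cy [O'y _]]; apply: clAD => //; exact: O'O.
    + by move=> y [/cl0 sy [/AO' O'y _]].
    + apply: (@within_eq _ _ _ f) => [a [Aa _]|]; first by rewrite f1A.
      by apply: within_sub cf => y [].
    + apply: (@within_eq _ _ _ g0) => [a [_ /= sa]|]; first by rewrite /f1 sa eqxx.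
      by apply: within_sub cg0 => y [O'y sy]; exact: O'0.
  - move=> y [[Ay Dy]|[O'y /= sy]]; first by rewrite f1A//; split; [exact: fA|exact: GD].
    by apply: GW; rewrite /f1 sy eqxx; apply: g0P; exact: O'0.
  by exists U, g; split => // y By; split; [exact: BU|exact: gf].
have [||||U1 [g1 [oU1 U1O cg1 g1W g1f]]] := half [set y | s y <= 0] G1 aG1.
- by apply: cl_le => y [].
- by move=> y /= ->.
- by move=> a Aa; exact: s1.
- by move=> w [].
have [||||U2 [g2 [oU2 U2O cg2 g2W g2f]]] := half [set y | 0 <= s y] G2 aG2.
- by apply: cl_ge => y [].
- by move=> y /= ->.
- by move=> a Aa; exact: s2.
- by move=> w [[]].
(* Both extensions must be defined on the level set; off it, only the one belonging to that side. *)
pose U := (U1 `&` U2) `|` ((U1 `&` [set y | s y < 0]) `|` (U2 `&` [set y | 0 < s y])).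
pose g y := if s y <= 0 then g1 y else g2 y.
have U_le y : U y -> s y <= 0 -> U1 y.
  by move=> [[]//|[[]//|[_ /= sy]]]; rewrite leNgt sy.
have U_ge y : U y -> 0 <= s y -> U2 y.
  by move=> [[]//|[[_ /= sy]|[]//]]; rewrite leNgt sy.
have gg y : U1 y -> s y = 0 -> g1 y = g2 y.
  move=> /U1O O'y sy; have [_ ->] := g1f y (or_intror (conj O'y sy)).
  by have [_ ->] := g2f y (or_intror (conj O'y sy)).
have AU1 a : A a -> s a <= 0 -> U1 a /\ g1 a = f a.
  by move=> Aa sa; rewrite -f1A//; apply: g1f; left.
have AU2 a : A a -> 0 <= s a -> U2 a /\ g2 a = f a.
  by move=> Aa sa; rewrite -f1A//; apply: g2f; left.
exists U, g; split.
- apply: openU; first exact: openI.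
  by apply: openU; exact: open_real_gt.
- split=> [a Aa|y].
    have [sa|sa|sa] := ltgtP (s a) 0.
    + by right; left; split => //; have [] := AU1 a Aa (ltW sa).
    + by right; right; split => //; have [] := AU2 a Aa (ltW sa).
    + by left; split; [have [] := AU1 a Aa|have [] := AU2 a Aa]; rewrite ?sa.
  by move=> [[/U1O/O'O]//|[[/U1O/O'O]//|[/U2O/O'O]]].
- have UE : (U `&` [set y | s y <= 0]) `|` (U `&` [set y | 0 <= s y]) = U.
    rewrite -setIUr; apply/seteqP; split=> [y []//|y Uy]; split => //=.
    by have [sy|sy] := leP (s y) 0; [left|right; exact: ltW].
  rewrite -UE; apply: within_setU.
  + move=> y [cy [Uy _]]; split => //=; by apply: cl_le cy => z [].
  + move=> y [cy [Uy _]]; split => //=; by apply: cl_ge cy => z [].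
  + apply: (@within_eq _ _ _ g1) => [y [_ /= sy]|]; first by rewrite /g sy.
    by apply: within_sub cg1 => y [Uy /= sy]; exact: U_le.
  + apply: (@within_eq _ _ _ g2) => [y [Uy /= sy]|].
      rewrite /g; case: ifPn => // sy'; apply/esym/gg; first exact: U_le.
      by apply/eqP; rewrite eq_le sy'.
    by apply: within_sub cg2 => y [Uy /= sy]; exact: U_ge.
- move=> y Uy; rewrite /g; case: ifPn => sy; first by have [] := g1W y (U_le _ Uy sy).
  have [] // := g2W y (U_ge _ Uy _); by rewrite ltW// ltNge.
- move=> a Aa; rewrite /g; case: ifPn => sa; first by have [] := AU1 a Aa sa.
  by have [] := AU2 a Aa _; rewrite ?ltW// ltNge.
Qed.

(** Extend each part [A_ i] of the domain separately, inside the set [V i] of points closer to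
    [A_ i] than to the rest of [A]. These sets are disjoint because [A_ j] is contained in [B_ i]
    for [i <> j]. *)
Lemma ANE_disjoint (C : topologicalType) (W : set C) (G : nat -> set C) :
  (forall i, open (G i)) -> (forall w, W w -> exists i, G i w) ->
  (forall i j w, W w -> G i w -> G j w -> i = j) ->
  (forall i, ANE R (W `&` G i)) -> ANE R W.
Proof.
move=> oG WG Gdisj aG Y O A f oO AO clA cf fA.
pose A_ i := A `&` f @^-1` G i; pose B_ i := A `\` f @^-1` G i.
pose V i := O `&` [set y | dist1 (A_ i) y < dist1 (B_ i) y].
have ext i : exists Ug : set Y * (Y -> C), [/\ open Ug.1, A_ i `<=` Ug.1 /\ Ug.1 `<=` V i,
    {within Ug.1, continuous Ug.2}, forall y, Ug.1 y -> (W `&` G i) (Ug.2 y) &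
    forall a, A_ i a -> Ug.2 a = f a].
  have [|||||U [g H]] := aG i Y (V i) (A_ i) f.
  - by apply: open_real_gt => //; exact: within_dist1.
  - move=> a [Aa Ga]; split; first exact: AO.
    rewrite /= dist1_in//; apply/dist1_gt0P.
    have /withinP/(_ a Aa (G i)) := cf => /(_ (open_nbhs_nbhs (conj (oG i) Ga))) aG'.
    by move=> /(_ _ aG')[y [[Ay nG'y] /(_ Ay)]].
  - move=> y [cy [Oy /= dy]].
    have Ay : A y by apply: clA; split => //; apply: closure_subset cy => z [].
    split => //; apply: contrapT => nGy; move: dy.
    by rewrite [X in _ < X]dist1_in ?ltNge ?dist1_ge0.
  - by apply: within_sub cf => y [].
  - by move=> a [Aa Ga]; split => //; exact: fA.
  by exists (U, g).
have [Ug {}ext] := choice ext.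
have UV i y : (Ug i).1 y -> V i y by have [_ [_ UV] _ _ _] := ext i; exact: UV.
have disj i j y : (Ug i).1 y -> (Ug j).1 y -> i = j.
  move=> /UV[Oy /= yi] /UV[_ /= yj]; apply/eqP/negPn/negP => /eqP ij.
  have AB k l : k <> l -> A_ k `<=` B_ l.
    by move=> kl a [Aa Gk]; split => // Gl; apply: kl; exact: Gdisj (fA a Aa) Gk Gl.
  have := dist1_sub y (AB _ _ ij); have := dist1_sub y (AB _ _ (nesym ij)); lra.
pose g y := if pselect (exists i, (Ug i).1 y) is left h then (Ug (sval (cid h))).2 y else f y.
have gE i y : (Ug i).1 y -> g y = (Ug i).2 y.
  move=> Uy; rewrite /g; case: pselect => [h|[]]; last by exists i.
  by case: cid => j /= Ujy; rewrite (disj _ _ _ Uy Ujy).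
have AU a : A a -> exists2 i, A_ i a & (Ug i).1 a.
  move=> Aa; have [i Gi] := WG _ (fA a Aa); exists i => //.
  by have [_ [AU _] _ _ _] := ext i; apply: AU.
exists (\bigcup_i (Ug i).1), g; split.
- by apply: bigcup_open => i _; have [] := ext i.
- split=> [a /AU[i _ Ua]|y [i _ /UV[]]//]; by exists i.
- apply: within_local => y [i _ Uy]; exists (Ug i).1.
    by have [oU _ _ _ _] := ext i; exact: open_nbhs_nbhs.
  apply: (@within_eq _ _ _ (Ug i).2) => [z [_ Uz]|]; first by rewrite (gE i).
  by have [_ _ cU _ _] := ext i; apply: within_sub cU => z [].
- move=> y [i _ Uy]; rewrite (gE i)//.
  by have [_ _ _ UW _] := ext i; have [] := UW _ Uy.
- move=> a /AU[i Aa Ua]; rewrite (gE i)//.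
  by have [_ _ _ _ gf] := ext i; exact: gf.
Qed.

Lemma ANE_increasing (C : metricType R) (W : set C) (G : nat -> set C) :
  (forall i, open (G i)) -> (forall i j, (i <= j)%N -> G i `<=` G j) ->
  (forall w, W w -> exists i, G i w) ->
  (forall i, ANE R (W `&` G i)) -> ANE R W.
Proof.
move=> oG Gmono WG aG.
pose b n : R := 2^-1 ^+ n.
have b0 n : 0 < b n by rewrite exprn_gt0// invr_gt0.
have b_le m n : (m <= n)%N -> b n <= b m.
  by move=> mn; apply: ler_wiXn2l => //; lra.
have b_lt m n : (m < n)%N -> b n < b m.
  by move=> mn; rewrite ltr_iXn2l//; lra.
(* If [w] is outside [G n], the terms with [k <= n] vanish and the others are at most [b n.+2]. So
   [p] is positive on [W], and [p w > b n.+2] forces [w] into [G n]: each annulus of [p] lies in one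
   [G n]. *)
pose t w n := Num.min (b n.+1) (dist1 (~` G n) w).
pose p w := bsup setT (t w).
have tb w n : setT n -> t w n <= b 1%N.
  by move=> _; rewrite ge_min b_le.
have p_lip x y : `|p x - p y| <= mdist x y.
  apply: (bsup_lip _ (@tb x) (@tb y)) => [|n _]; first exact: mdist_ge0.
  by apply: le_trans (dist1_lip (~` G n) x y); rewrite /t; case_real => *; lra.
have cp D : {within D, continuous p}.
  apply/within_realP => a _ e e0; apply: filterS (near_mdist a e0) => y /= h _.
  exact: le_lt_trans (p_lip _ _) h.
have p0 w : W w -> 0 < p w.
  move=> /WG[i Gw]; apply: lt_le_trans (bsup_ge (@tb w) (I : setT i)).
  rewrite lt_min b0/=; apply/dist1_gt0P.
  by move=> cG; have [z [nG Gz]] := cG _ (open_nbhs_nbhs (conj (oG i) Gw)).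
have p1 w : p w < b 0%N.
  apply: (@le_lt_trans _ _ (b 1%N)); last exact: b_lt.
  by apply: bsup_le (@tb w); exact: ltW.
have pG w n : b n.+2 < p w -> G n w.
  move=> h; apply: contrapT => nG; move: h; rewrite ltNge => /negP; apply.
  apply: bsup_le => [|k _]; first exact: ltW.
  rewrite ge_min; have [kn|nk] := leqP k n; last by rewrite b_le.
  by rewrite dist1_in ?(ltW (b0 _)) ?orbT// => /(Gmono _ _ kn).
pose An n := [set w | b n.+2 < p w < b n].
have oAn n : open (An n).
  have -> : An n = (setT `&` [set w | b n.+2 < p w]) `&` [set w | p w < b n].
    by rewrite setTI; apply/seteqP; split=> [w /andP[]|w [/= ? ?]]//; apply/andP.
  have cc (x : R) D : {within D, continuous (fun=> x : R)}.
    by move=> C'; apply: continuous_withinT; exact: cst_continuous.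
  by do 2![apply: open_real_gt => //]; exact: openT.
have An_cover w : W w -> exists n, An n w.
  move=> Ww; have ex : exists m, b m < p w.
    have pw := p0 w Ww.
    have [m hm] : exists m : nat, (p w)^-1 < m%:R.
      by exists (Num.truncn (p w)^-1).+1; apply: truncnS_gt.
    exists m; rewrite /b exprVn invf_plt ?posrE ?exprn_gt0//.
    apply: lt_le_trans hm _; rewrite -natrX ler_nat; apply: ltnW; exact: ltn_expl.
  (* The least index whose [b] lies below [p w], lowered by 2, names an annulus containing [w].
     Index 1 falls into annulus 0, and index 0 is excluded by [p1]. *)
  case: (ex_minnP ex) => -[|[|m]] bm min_m.
  - by have := p1 w; rewrite ltNge (ltW bm).
  - exists 0%N; rewrite /An/= p1 andbT; apply: le_lt_trans bm; exact: b_le.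
  - exists m; rewrite /An/= bm/=; apply: (@le_lt_trans _ _ (b m.+1)).
      by rewrite leNgt; apply/negP => /min_m; rewrite ltnn.
    exact: b_lt.
pose Ev e := \bigcup_n An (n.*2 + e)%N.
have aEv e : ANE R (W `&` Ev e).
  apply: (@ANE_disjoint _ _ (fun n => An (n.*2 + e)%N)).
  - by move=> i; exact: oAn.
  - by move=> w [_ [n _ Aw]]; exists n.
  - have H i j w : (i < j)%N -> An (i.*2 + e)%N w -> An (j.*2 + e)%N w -> False.
      move=> ij /andP[h _] /andP[_ h']; have := lt_trans h h'.
      by rewrite ltNge b_le// -!addSn leq_add2r -doubleS leq_double.
    move=> i j w _ wi wj; have [ij|ij|//] := ltngtP i j; exfalso.
      exact: H ij wi wj.
    exact: H ij wj wi.
  - move=> i; set k := (_ + _)%N.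
    have -> : W `&` Ev e `&` An k = W `&` G k `&` An k.
      apply/seteqP; split=> w [[Ww _] Aw]; split => //; split => //.
        by apply: pG; case/andP: Aw.
      by exists i.
    exact: ANE_setI_open.
apply: (@ANE_union2 _ _ (Ev 0%N) (Ev 1%N)) => //.
- by apply: bigcup_open => n _.
- by apply: bigcup_open => n _.
- move=> w /An_cover[n Aw]; rewrite -(odd_double_half n) addnC in Aw.
  by case: (odd n) Aw => Aw; [right|left]; exists n./2.
Qed.

Lemma ANE_bigcup (C : metricType R) (W : set C) (G : nat -> set C) :
  (forall i, open (G i)) -> (forall w, W w -> exists i, G i w) ->
  (forall i, ANE R (W `&` G i)) -> ANE R W.
Proof.
move=> oG WG aG; pose H n := \bigcup_(i in [set i | (i < n)%N]) G i.
have oH n : open (H n) by apply: bigcup_open => i _.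
apply: (@ANE_increasing _ _ H) => //.
- by move=> i j ij w [k /= ki Gw]; exists k => //=; exact: leq_trans ij.
- by move=> w /WG[i Gw]; exists i.+1, i => /=.
elim=> [|n IH].
  have -> : W `&` H 0%N = set0 by rewrite -subset0 => w [_ [k]].
  exact: ANE0.
have HG w : H n.+1 w -> H n w \/ G n w.
  move=> [k /=]; rewrite ltnS leq_eqVlt => /orP[/eqP ->|kn Gw]; first by right.
  by left; exists k.
have HS : H n `<=` H n.+1 by move=> w [k /= kn Gw]; exists k => //=; exact: ltnW.
have GS : G n `<=` H n.+1 by move=> w Gw; exists n => /=.
apply: (@ANE_union2 _ _ (H n) (G n)) => //.
- by move=> w [_ /HG].
- by rewrite -setIA (setIidr HS).
- by rewrite -setIA (setIidr GS).
Qed.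

End Hanner.

(** * From a resolution to a corona *)

Section SequentialCompactness.
Local Open Scope ring_scope.
Variable R : realType.

Lemma inv_succ_small (e : R) : 0 < e ->
  exists n, forall m, (n <= m)%N -> m.+1%:R^-1 < e.
Proof.
move=> e0; exists (Num.truncn e^-1) => m nm.
rewrite invf_plt ?posrE//.
by apply: lt_le_trans (truncnS_gt _) _; rewrite ler_nat ltnS.
Qed.

Lemma ultra_seq_cover (T I : Type) (F : set_system T) (B : I -> set T) (s : seq I) :
  UltraFilter F -> F (\bigcup_(i in [set i | List.In i s]) B i) ->
  exists i, List.In i s /\ F (B i).
Proof.
move=> FU; elim: s => [|i s IH] FB.
  by have [x [i []]] := filter_ex FB.
have [FBi|FCi] := in_ultra_setVsetC (B i) FU.
  by exists i; split => //; left.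
have [|k [sk Bk]] := IH; last by exists k; split => //; right.
apply: filterS2 FB FCi => x [k [<-|sk] Bk] nB; first by case: nB.
by exists k.
Qed.

(** By total boundedness, an ultrafilter on [K] contains a ball of each radius [1/(n+1)]. Points
    chosen in common to the first of these balls form a sequence whose cluster point is a limit of
    the ultrafilter. *)
Lemma sequentially_compact (X : topologicalType) (K : set X) :
  metrizable R X ->
  (forall u : nat -> X, (forall n, K (u n)) ->
    exists2 x, K x & forall N, nbhs x N -> forall n, exists2 m, (n <= m)%N & N (u m)) ->
  compact K.
Proof.
move=> /metrizableP[M [j [ji je]]] seqK.
pose d x y := mdist (j x) (j y).
have nbhs_d x e : 0 < e -> nbhs x [set y | d x y < e].
  move=> e0; apply/je; exists [set z | mdist (j x) z < e] => //; exact: near_mdist.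
have totally_bounded e : 0 < e -> exists s : seq X, (forall x, List.In x s -> K x) /\
    forall x, K x -> exists y, List.In y s /\ d y x < e.
  (* Otherwise successive choices give an [e]-separated sequence in [K], which cannot cluster. The
     state of the iteration is the list of points chosen so far. *)
  move=> e0; apply: contrapT => H.
  have next (s : {s : seq X | forall x, List.In x s -> K x}) :
      exists x, K x /\ forall y, List.In y (sval s) -> e <= d y x.
    apply: contrapT => H'; apply: H; exists (sval s); split; first exact: (svalP s).
    move=> x Kx; apply: contrapT => H''; apply: H'; exists x; split => // y sy.
    by rewrite leNgt; apply/negP => yx; apply: H''; exists y.
  have [nx nxP] := choice next.
  have stepP (s : {s : seq X | forall x, List.In x s -> K x}) :
      forall x, List.In x (nx s :: sval s) -> K x.
    by move=> x [<-|]; [have [] := nxP s|exact: (svalP s)].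
  pose step s := exist (fun s => forall x, List.In x s -> K x) _ (stepP s).
  have nilP : forall x, List.In x (@nil X) -> K x by [].
  pose s0 := exist (fun s => forall x, List.In x s -> K x) _ nilP.
  pose L n := iter n step s0.
  pose u n := nx (L n).
  have inL m n : (m < n)%N -> List.In (u m) (sval (L n)).
    elim: n => // n IH; rewrite ltnS leq_eqVlt => /orP[/eqP ->|mn]; first by left.
    by right; exact: IH.
  have sep m n : (m < n)%N -> e <= d (u m) (u n).
    by move=> mn; have [_] := nxP (L n); apply; exact: inL.
  have [|x Kx xu] := seqK u; first by move=> n; have [] := nxP (L n).
  have e2 : 0 < e / 2 by rewrite divr_gt0.
  have [m _ um] := xu _ (nbhs_d x _ e2) 0%N.
  have [n mn un] := xu _ (nbhs_d x _ e2) m.+1.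
  have := sep m n mn; have := metric_triangle (j (u m)) (j x) (j (u n)).
  by rewrite (metric_sym (j (u m)) (j x)); move: um un; rewrite /= /d; lra.
rewrite compact_ultra => F FU FK.
have center n : exists x, K x /\ F [set y | d x y < n.+1%:R^-1].
  have [|s [sK sP]] := totally_bounded n.+1%:R^-1; first by rewrite invr_gt0.
  have [|x [sx Fx]] := @ultra_seq_cover _ _ F (fun x => [set y | d x y < n.+1%:R^-1]) s FU.
    by apply: filterS FK => x /sP[y [sy yx]]; exists y.
  by exists x; split => //; exact: sK.
have [c cP] := choice center.
(* Using the first [n + 1] balls at once puts [u m] near [c n] for all [m >= n]; hence a cluster
   point of [u] is near [c n] once [n] is large. *)
have Fc n : F (K `&` [set y | forall k, (k <= n)%N -> d (c k) y < k.+1%:R^-1]).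
  apply: filterI => //; elim: n => [|n IH].
    by have [_] := cP 0%N; apply: filterS => y cy k; rewrite leqn0 => /eqP ->.
  apply: filterS2 IH (cP n.+1).2 => y IH cy k.
  by rewrite leq_eqVlt => /orP[/eqP ->//|]; exact: IH.
have [u uP] := choice (fun n => filter_ex (Fc n)).
have [|x Kx xu] := seqK u; first by move=> n; have [] := uP n.
exists x; split => // N /je[V /nbhs_mdist[e e0 eV] VN].
have e4 : 0 < e / 4 by rewrite divr_gt0.
have [n hn] := inv_succ_small e4.
have [m nm um] := xu _ (nbhs_d x _ e4) n.
have [_ /(_ n nm) cu] := uP m; have hn' := hn n (leqnn n).
apply: filterS (cP n).2 => y cy; apply: VN; apply: eV.
move: hn' cy um cu; rewrite /= /d; move: n.+1%:R^-1 => z.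
have := metric_triangle (j x) (j (u m)) (j y).
have := metric_triangle (j (u m)) (j (c n)) (j y).
rewrite (metric_sym (j (u m)) (j (c n))); lra.
Qed.

End SequentialCompactness.

Section ResolutionToCorona.
Local Open Scope ring_scope.
Variable R : realType.

Lemma ANE_bigcup_metrizable (C : topologicalType) (W : set C) (G : nat -> set C) :
  metrizable R C -> (forall i, open (G i)) -> (forall w, W w -> exists i, G i w) ->
  (forall i, ANE R (W `&` G i)) -> ANE R W.
Proof.
move=> [M [h [ch [g [cg hK gK]]]]] oG WG aG.
have cw (T T' : topologicalType) (f : T -> T') P : continuous f -> {within P, continuous f}.
  exact: continuous_withinT.
apply: (@ANE_retract _ _ _ W (g @^-1` W) h g (cw _ _ _ _ ch) _ (cw _ _ _ _ cg)) => //.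
  by move=> x Wx; rewrite /= hK.
apply: (@ANE_bigcup _ _ _ (fun i => g @^-1` G i)).
- by move=> i; apply: open_comp (oG i) => x _; exact: cg.
- by move=> w /WG.
- move=> i; apply: (@ANE_retract _ _ _ _ (W `&` G i) g h (cw _ _ _ _ cg) _
    (cw _ _ _ _ ch)) => // x [Wx Gx].
  by split; rewrite /= hK.
Qed.

Lemma metrizable_nbhs_neq (X : topologicalType) (x y : X) :
  metrizable R X -> x <> y -> nbhs x [set z | z <> y].
Proof.
move=> /metrizableP[M [j [ji je]]] xy; apply/je.
exists [set z | mdist (j x) z < mdist (j x) (j y)].
  by apply: near_mdist; rewrite mdist_gt0; apply/eqP => /ji.
by move=> z h zy; move: h; rewrite zy /= ltxx.
Qed.

Lemma limit_projection (S : inverse_sequence) (X : topologicalType)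
    (q : forall n : nat, X -> S n) : is_inverse_limit q ->
  (forall n, continuous (q n)) /\
  (forall m n (le_nm : (n <= m)%N) x, bond le_nm (q m x) = q n x).
Proof.
move=> [h [ch _] hq]; split=> [n|m n le x]; last first.
  by rewrite -!hq; have /set_mem := valP (h x); apply.
have -> : q n = @proj _ (fun n => S n) n \o (\val \o h).
  by apply/funext => x; rewrite -hq.
move=> x; apply: continuous_comp; last exact: proj_continuous.
by apply: continuous_comp; [exact: ch|exact: embeds_continuous (@embeds_val _ _) _].
Qed.

Section Corona.
Variables (S : inverse_sequence) (X : topologicalType).
Variable q : forall n : nat, X -> S n.
Hypothesis mX : metrizable R X.
Hypothesis res : is_resolution R q.
Hypothesis aS : forall (i j : nat) (le_ji : (j <= i)%N),
  ANR R (range (@bond S i j le_ji) : Type).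

Let cq n : continuous (q n).
Proof. by have [] := limit_projection (resolution_limit res). Qed.

Let bq m n (le_nm : (n <= m)%N) x : bond le_nm (q m x) = q n x.
Proof. by have [_] := limit_projection (resolution_limit res). Qed.

(* The topology of X at a is induced by the projection to the n-th stage. *)
Let detected n a := forall N, nbhs a N ->
  exists2 V, nbhs (q n a) V & forall x, V (q n x) -> N x.

(** Over [U], stage [n] induces the topology of [X], and the image of stage [m] is that of [X] (the
    other inclusion is automatic). So an open piece of an ANR is a copy of an open piece of [X]. *)
Let settled n m (le_nm : (n <= m)%N) (y : S n) := exists U, [/\ open U, U y,
  forall a, U (q n a) -> detected n a &
  U `&` range (@bond S m n le_nm) `<=` range (q n)].

Let O n m := [set x | exists le_nm : (n <= m)%N, settled le_nm (q n x)].

Let open_settled n m (le_nm : (n <= m)%N) : open (settled le_nm).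
Proof.
rewrite openE => y [U [oU Uy Ud Ur]].
by apply: filterS (open_nbhs_nbhs (conj oU Uy)) => y' Uy'; exists U.
Qed.

Let open_O n m : open (O n m).
Proof.
rewrite openE => x [le_nm sx].
have : nbhs x (q n @^-1` settled le_nm) :=
  @cq n x _ (open_nbhs_nbhs (conj (open_settled le_nm) sx)).
by apply: filterS => x' sx'; exists le_nm.
Qed.

Let detected_inj n a x : detected n a -> q n x = q n a -> x = a.
Proof.
move=> da xa; apply: contrapT => nxa.
have [V Va VN] := da _ (metrizable_nbhs_neq mX (nesym nxa)).
by apply: (VN x) => //; rewrite xa; exact: nbhs_singleton.
Qed.

(** [q n] is a homeomorphism from [O n m] onto the settled part of the ANR [A]; [r] is its inverse,
    and its continuity is what [detected] says. *)
Let ANE_O n m : ANE R (O n m).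
Proof.
have [[x0 [le_nm sx0]]|O0] := pselect (exists x, O n m x); last first.
  by have -> : O n m = set0; [rewrite -subset0 => x Ox; apply: O0; exists x|exact: ANE0].
pose A := range (@bond S m n le_nm).
have aA : ANE R A := ANR_ANE_set (aS le_nm).
pose r y := if pselect (exists x, q n x = y) is left h then sval (cid h) else x0.
have qr y : (A `&` settled le_nm) y -> q n (r y) = y.
  move=> [Ay [U [oU Uy _ UA]]]; rewrite /r; case: pselect => [h|[]].
    by case: cid.
  by have [x _ <-] := UA y (conj Uy Ay); exists x.
have dr y : (A `&` settled le_nm) y -> detected n (r y).
  by move=> Py; have [_ [U [oU Uy + _]]] := Py; apply; rewrite qr.
apply: (@ANE_retract _ _ _ _ (A `&` settled le_nm) (q n) r).
- exact: continuous_withinT.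
- move=> x [le' sx]; split; first by exists (q m x); rewrite // bq.
  by rewrite (bool_irrelevance le_nm le').
- apply/withinP => y Py N rN; have [V] := dr y Py N rN.
  rewrite qr// => yV VN; apply: filterS yV => y' Vy' Py'.
  by apply: VN; rewrite qr.
- by move=> y Py; exists le_nm; rewrite qr//; case: Py.
- move=> x [le' sx]; apply: (@detected_inj n).
    have [U [_ Uy + _]] := sx; exact.
  apply: qr; split; first by exists (q m x); rewrite // bq.
  by rewrite (bool_irrelevance le_nm le').
- exact: ANE_setI_open (open_settled le_nm) aA.
Qed.

Let K := ~` \bigcup_n \bigcup_m O n m.

Let open_CK : open (~` K).
Proof. by rewrite setCK; apply: bigcup_open => n _; apply: bigcup_open => m _. Qed.

Let ANE_CK : ANE R (~` K).
Proof.
pose G k := if unpickle k is Some nm then O nm.1 nm.2 else set0 : set X.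
apply: (@ANE_bigcup_metrizable _ _ G) => // [k|x|k].
- by rewrite /G; case: unpickle => [nm|]; [exact: open_O|exact: open0].
- rewrite setCK => -[n _ [m _ Ox]]; exists (pickle (n, m)).
  by rewrite /G pickleK.
- have -> : ~` K `&` G k = G k.
    rewrite setCK setIidr// /G; case: unpickle => // -[n m] x Ox.
    by exists n => //; exists m.
  by rewrite /G; case: unpickle => [nm|]; [exact: ANE_O|exact: ANE0].
Qed.

Let pullback_nbhs m n (le_nm : (n <= m)%N) x V : nbhs (q n x) V ->
  nbhs (q m x) [set y | V (bond le_nm y)].
Proof. by move=> xV; apply: (@bond_continuous S); rewrite bq. Qed.

Section NoCluster.
Variable u : nat -> X.
Hypothesis Ku : forall n, K (u n).
Hypothesis noc : forall x : X, exists2 N : set X, nbhs x N &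
  exists n, forall m, (n <= m)%N -> ~ N (u m).

(** The open sets missing a tail of [u] cover [X], and (B2) moves this cover to a stage. *)
Let eventually_separated : exists j, forall m, (j <= m)%N -> forall x,
  exists2 V, nbhs (q m x) V & exists n, forall k, (n <= k)%N -> ~ V (q m (u k)).
Proof.
pose C := [set W : set X | open W /\ exists n, forall m, (n <= m)%N -> ~ W (u m)].
have [|j [D [[oD DT] DC]]] := resolution_B2 res (C := C).
  split=> [W []//|]; rewrite -subTset => x _.
  have [N xN [n hn]] := noc x; exists N°.
    split; first exact: open_interior.
    by exists n => m nm /interior_subset; exact: hn.
  exact: xN.
exists j => m jm x.
have [V DV Vx] : (\bigcup_(V in D) V) (q j x) by rewrite DT.
have [|W [_ [n hn]] VW] := DC (q j @^-1` V); first by exists V.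
exists [set y | V (bond jm y)].
  by apply: pullback_nbhs; apply: open_nbhs_nbhs; split => //; exact: oD.
by exists n => k nk /=; rewrite bq => /VW; exact: hn.
Qed.

Variables (M : metricType R) (i : X -> M).
Hypothesis ie : embeds i.

Let nbhs_d x e : 0 < e -> nbhs x [set y | mdist (i x) (i y) < e].
Proof.
move=> e0; apply/(ie.2 x); exists [set z | mdist (i x) z < e] => //.
exact: near_mdist.
Qed.

Let nbhs_finite (T : topologicalType) (x : T) (P : nat -> set T) n :
  (forall k, nbhs x (P k)) -> nbhs x [set y | forall k, (k < n)%N -> P k y].
Proof.
move=> xP; elim: n => [|n IH]; first by apply: filterS filterT.
apply: filterS2 IH (xP n) => y IH Pn k; rewrite ltnS leq_eqVlt => /orP[/eqP ->//|].
exact: IH.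
Qed.

(** If all points near the tail of [u] were detected at stage [m], then, [u k] being unsettled, some
    point [z k] in the image of stage [k] but not of [X] would lie close to [q m (u k)]. Deleting
    all [z k] from stage [m] leaves a neighborhood of the image of [X] that contradicts (B1). *)
Let undetected_near m : (forall x, exists2 V, nbhs (q m x) V &
    exists n, forall k, (n <= k)%N -> ~ V (q m (u k))) ->
  exists k a, [/\ (m <= k)%N, mdist (i (u k)) (i a) < m.+1%:R^-1 & ~ detected m a].
Proof.
move=> sep; apply: contrapT => H.
have all_d k a : (m <= k)%N -> mdist (i (u k)) (i a) < m.+1%:R^-1 -> detected m a.
  by move=> mk ka; apply: contrapT => nd; apply: H; exists k, a.
have m0 : 0 < m.+1%:R^-1 :> R by rewrite invr_gt0.
have [Mm [l le]] := (metrizableP R (S m)).1 (resolution_metrizable res m).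
have zP k : exists z, forall mk : (m <= k)%N, [/\ mdist (l (q m (u k))) (l z) < k.+1%:R^-1,
    range (@bond S k m mk) z & ~ range (q m) z].
  have [mk|km] := pselect (m <= k)%N; last by exists (q m (u k)).
  have dk : detected m (u k) by apply: (all_d k) => //; rewrite mdistxx.
  have [V + VN] := dk _ (nbhs_d (u k) m0).
  rewrite nbhsE => -[V' [oV' V'u] V'V].
  pose U := V' `&` l @^-1` [set z | mdist (l (q m (u k))) z < k.+1%:R^-1]°.
  have oU : open U.
    apply: openI => //; apply: open_comp; last exact: open_interior.
    by move=> z _; exact: embeds_continuous.
  have Uu : U (q m (u k)).
    by split => //; apply: near_mdist; rewrite invr_gt0.
  have : ~ (U `&` range (@bond S k m mk) `<=` range (q m)).
    have nK : ~ (~` K) (u k) by apply; exact: Ku.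
    move=> UA; apply: nK; rewrite setCK; exists m => //; exists k => //; exists mk; exists U.
    by split => // a [/V'V/VN ua _]; exact: all_d ua.
  move=> /existsNP[z /not_implyP[[[V'z /interior_subset Uz] bz] nz]].
  by exists z => mk'; rewrite (bool_irrelevance mk' mk).
have [z {}zP] := choice zP.
(* Near a given [q m x] only finitely many [z k] matter: the later ones are close to points
   [q m (u k)], which eventually stay away from [q m x]. *)
have [|k [mk]] := resolution_B1 res (n := m) (U := [set y | forall k, (m <= k)%N -> y <> z k]).
  move=> _ [x _ <-].
  have [V xV [n hn]] := sep x.
  have /(le.2 (q m x))[V' /nbhs_mdist[e e0 eV'] V'V] := xV.
  have e2 : 0 < e / 2 by rewrite divr_gt0.
  have [n' hn'] := inv_succ_small e2.
  have near1 : nbhs (q m x) [set y | forall k, (k < maxn n n')%N -> (m <= k)%N -> y <> z k].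
    apply: nbhs_finite => k; have [mk|km] := pselect (m <= k)%N; last first.
      by apply: filterS filterT => y _ /km.
    have [_ _ nz] := zP k mk.
    apply: filterS (metrizable_nbhs_neq (resolution_metrizable res m) (y := z k) _) => //.
    by move=> xz; apply: nz; rewrite -xz; exists x.
  have near2 : nbhs (q m x) [set y | mdist (l (q m x)) (l y) < e / 2].
    apply/(le.2 (q m x)); exists [set w | mdist (l (q m x)) w < e / 2] => //.
    exact: near_mdist.
  apply: filterS2 near1 near2 => y y1 y2 k mk yz.
  have [kn|nk] := ltnP k (maxn n n'); first exact: (y1 k).
  move: nk; rewrite geq_max => /andP[nk n'k].
  apply: (hn k nk); apply: V'V; apply: eV'.
  have [+ _ _] := zP k mk; have := hn' k n'k; move: y2; rewrite /= yz.
  move: k.+1%:R^-1 => w.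
  have := metric_triangle (l (q m x)) (l (z k)) (l (q m (u k))).
  by rewrite (metric_sym (l (z k))); lra.
have [_ bz _] := zP k mk.
by move=> /(_ _ bz) /(_ k mk).
Qed.

(** For each large [m] there is a point [a m] near the sequence with a neighborhood [G m] that
    contains the preimage of no neighborhood at stage [m]. As the [a m] do not cluster either, one
    open cover can witness all these failures, against (B2). *)
Lemma corona_no_cluster_absurd : False.
Proof.
have [j sep] := eventually_separated.
have step m : exists aG : X * set X, (j <= m)%N -> [/\
    exists2 k, (m <= k)%N & mdist (i (u k)) (i aG.1) < m.+1%:R^-1,
    nbhs aG.1 aG.2 &
    forall V, nbhs (q m aG.1) V -> exists2 x, V (q m x) & ~ aG.2 x].
  have [jm|mj] := pselect (j <= m)%N; last by exists (u 0%N, setT).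
  have [k [a [mk ka nd]]] := undetected_near (sep m jm).
  have /existsNP[N /not_implyP[aN nV]] := nd.
  exists (a, N) => _; split => //=; first by exists k.
  move=> V aV; apply: contrapT => H; apply: nV; exists V => // x Vx.
  by apply: contrapT => nN; apply: H; exists x.
have [aG {step}aGP] := choice step.
pose a m := (aG m).1; pose G m := (aG m).2.
(* Any member containing [a m] is so small that it lies in [G m]. A small neighborhood of a point
   [x] meets this demand, since it contains none of the [a m] except finitely many equal to [x]. *)
pose C := [set W : set X | open W /\ forall m, (j <= m)%N -> W (a m) -> W `<=` G m].
have [|n [D [[oD DT] DC]]] := resolution_B2 res (C := C).
  split=> [W []//|]; rewrite -subTset => x _.
  have [N xN [n hn]] := noc x.
  have /(ie.2 x)[V /nbhs_mdist[e e0 eV] VN] := xN.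
  have e2 : 0 < e / 2 by rewrite divr_gt0.
  have [n' hn'] := inv_succ_small e2.
  have near1 : nbhs x [set y | forall m, (m < maxn n n')%N -> (j <= m)%N ->
      (a m = x -> G m y) /\ (a m <> x -> y <> a m)].
    apply: nbhs_finite => m; have [jm|mj] := pselect (j <= m)%N; last first.
      by apply: filterS filterT => y _ /mj.
    have [_ aN _] := aGP m jm.
    have [ax|nax] := pselect (a m = x).
      by move: aN; rewrite -/(a m) ax; apply: filterS => y Gy _.
    by apply: filterS (metrizable_nbhs_neq mX (nesym nax)) => y ya _.
  have near2 := nbhs_d x e2.
  have xW := filterI near1 near2.
  exists ([set y | forall m, (m < maxn n n')%N -> (j <= m)%N ->
      (a m = x -> G m y) /\ (a m <> x -> y <> a m)] `&`
      [set y | mdist (i x) (i y) < e / 2])°; last exact: xW.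
  split; first exact: open_interior.
  move=> m jm /interior_subset[a1 a2] y /interior_subset[y1 _].
  have [mn|nm] := ltnP m (maxn n n').
    have [ax|nax] := pselect (a m = x); first exact: (y1 m mn jm).1.
    by have [_ /(_ nax)] := a1 m mn jm.
  exfalso; move: nm; rewrite geq_max => /andP[nm n'm].
  have [[k mk ka] _ _] := aGP m jm.
  apply: (hn k (leq_trans nm mk)); apply: VN; apply: eV.
  have := hn' m n'm; move: ka a2 => /=; move: m.+1%:R^-1 => w.
  have := metric_triangle (i x) (i (a m)) (i (u k)).
  by rewrite -/(a m) (metric_sym (i (a m))); lra.
pose m := maxn n j.
have nm : (n <= m)%N by rewrite leq_maxl.
have jm : (j <= m)%N by rewrite leq_maxr.
have [V DV Va] : (\bigcup_(V in D) V) (q n (a m)) by rewrite DT.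
have [|W [oW WG] VW] := DC (q n @^-1` V); first by exists V.
have [_ _ /(_ [set y | V (bond nm y)])] := aGP m jm.
case=> [|x /=].
  by apply: pullback_nbhs; apply: open_nbhs_nbhs; split => //; exact: oD.
rewrite bq => /VW Wx; apply; apply: (WG m jm) Wx.
exact: VW.
Qed.

End NoCluster.

Lemma resolution_coronated : coronated_ANR R X.
Proof.
split => //; exists K; last exact: ANE_set_ANR mX ANE_CK.
apply: sequentially_compact mX _ => u Ku; apply: contrapT => H.
have [M [i ie]] := (metrizableP R X).1 mX.
apply: (@corona_no_cluster_absurd u Ku _ M i ie) => x.
have [Kx|nKx] := pselect (K x); last first.
  exists (~` K); first exact: (open_nbhs_nbhs (conj open_CK nKx)).
  by exists 0%N => m _; apply; exact: Ku.
apply: contrapT => H'; apply: H; exists x => // N xN n.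
apply: contrapT => H''; apply: H'; exists N => //; exists n => m nm Nm.
by apply: H''; exists m.
Qed.

End Corona.
End ResolutionToCorona.

(** * Operations on cubes *)

Section CubeOperations.
Local Open Scope ring_scope.
Context {R : realType} {Y : topologicalType}.
Implicit Types A : set Y.

Lemma within_lip A (f : Y -> R) (g : R -> R) :
  (forall x y, `|g x - g y| <= `|x - y|) -> {within A, continuous f} ->
  {within A, continuous (fun y => g (f y))}.
Proof.
move=> gl /within_realP cf; apply/within_realP => a Aa e e0.
by apply: filterS (cf a Aa e e0) => y h Ay; exact: le_lt_trans (gl _ _) (h Ay).
Qed.

Lemma within_eval S A (f : Y -> cube R S) s : {within A, continuous f} ->
  {within A, continuous (fun y => f y s)}.
Proof.
by move=> cf; apply: (within_comp cf (@within_coord _ _ setT s)).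
Qed.

Lemma within_dist1_comp (M : metricType R) A (B : set M) (f : Y -> M) :
  {within A, continuous f} -> {within A, continuous (fun y => dist1 B (f y))}.
Proof.
by move=> cf; apply: (within_comp cf (@within_dist1 _ _ setT B)).
Qed.

Lemma within_mdist (M : metricType R) A (f g : Y -> M) :
  {within A, continuous f} -> {within A, continuous g} ->
  {within A, continuous (fun y => mdist (f y) (g y))}.
Proof.
move=> /within_mdistP cf /within_mdistP cg; apply/within_realP => a Aa e e0.
have e2 : 0 < e / 2 by rewrite divr_gt0.
apply: filterS2 (cf a Aa _ e2) (cg a Aa _ e2) => y /= hf hg Ay.
have {}hf := hf Ay; have {}hg := hg Ay.
have := metric_triangle (f a) (f y) (g a).
have := metric_triangle (f y) (f a) (g y).
have := metric_triangle (f y) (g y) (g a).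
have := metric_triangle (f a) (g a) (g y).
by rewrite (metric_sym (f y) (f a)) (metric_sym (g y) (g a)) ltr_norml; lra.
Qed.

Definition creindex S S' (g : S' -> S) (u : cube R S) : cube R S' :=
  cube_of (fun s => u (g s)).

Lemma creindexE S S' (g : S' -> S) (u : cube R S) s : creindex g u s = u (g s).
Proof. by rewrite /= clip_id// cube_itv. Qed.

Lemma within_creindex S S' (g : S' -> S) A (f : Y -> cube R S) :
  {within A, continuous f} -> {within A, continuous (fun y => creindex g (f y))}.
Proof.
move=> /within_cubeP cf; apply/within_cubeP => a Aa e e0.
by apply: filterS (cf a Aa e e0) => y h Ay s; rewrite !creindexE; exact: h.
Qed.

Definition cpair S S' (u : cube R S) (v : cube R S') : cube R (S + S') :=
  cube_of (fun s => match s with inl s => u s | inr s => v s end).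

Lemma cpairE S S' (u : cube R S) (v : cube R S') s :
  cpair u v s = match s with inl s => u s | inr s => v s end.
Proof. by rewrite /= clip_id//; case: s => s; exact: cube_itv. Qed.

Lemma cpair_inl S S' (u : cube R S) (v : cube R S') : creindex inl (cpair u v) = u.
Proof. by apply: cubeP => s; rewrite creindexE cpairE. Qed.

Lemma cpair_inr S S' (u : cube R S) (v : cube R S') : creindex inr (cpair u v) = v.
Proof. by apply: cubeP => s; rewrite creindexE cpairE. Qed.

Lemma cpair_eta S S' (w : cube R (S + S')) :
  cpair (creindex inl w) (creindex inr w) = w.
Proof. by apply: cubeP => -[s|s]; rewrite cpairE creindexE. Qed.

Lemma within_cpair S S' A (f : Y -> cube R S) (g : Y -> cube R S') :
  {within A, continuous f} -> {within A, continuous g} ->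
  {within A, continuous (fun y => cpair (f y) (g y))}.
Proof.
move=> /within_cubeP cf /within_cubeP cg; apply/within_cubeP => a Aa e e0.
apply: filterS2 (cf a Aa e e0) (cg a Aa e e0) => y hf hg Ay [s|s].
  by rewrite !cpairE hf.
by rewrite !cpairE hg.
Qed.

(** Clipping admits factors above 1, so that multiplying by [t^-1] undoes a scaling by [t]. *)
Definition cscale S (t : R) (u : cube R S) : cube R S := cube_of (fun s => t * u s).

Lemma cscale0 S (u : cube R S) s : cscale 0 u s = 0.
Proof. by rewrite /= mul0r clip_id// lexx ler01. Qed.

Lemma cscaleE S t (u : cube R S) s : 0 <= t <= 1 -> cscale t u s = t * u s.
Proof.
move=> /andP[t0 t1]; rewrite /= clip_id// mulr_ge0 ?cube_ge0//=.
by rewrite mulr_ile1 ?cube_ge0 ?cube_le1.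
Qed.

Lemma cscale_le S t (u : cube R S) s : 0 <= t -> cscale t u s <= t.
Proof.
move=> t0; have : t * u s <= t by rewrite ler_piMr ?cube_le1.
have : 0 <= t * u s by rewrite mulr_ge0 ?cube_ge0.
by rewrite /= /clip; move: (t * u s) => x; case_real => *; lra.
Qed.

Lemma cscaleK S t (u : cube R S) : 0 < t <= 1 -> cscale t^-1 (cscale t u) = u.
Proof.
move=> /andP[t0 t1]; apply: cubeP => s.
rewrite {1}/cscale cube_ofE cscaleE ?(ltW t0)// mulrA mulVf ?gt_eqF//.
by rewrite mul1r clip_id// cube_itv.
Qed.

Lemma within_cscale S A (t : Y -> R) (u : Y -> cube R S) :
  {within A, continuous t} -> {within A, continuous u} ->
  {within A, continuous (fun y => cscale (t y) (u y))}.
Proof.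
move=> /within_realP ct /within_cubeP cu; apply/within_cubeP => a Aa e e0.
pose b := `|t a| + 1.
have b0 : 0 < b by rewrite /b ltr_wpDl.
have e2 : 0 < e / 2 by rewrite divr_gt0.
have eb : 0 < e / 2 / b by rewrite divr_gt0.
apply: filterS2 (ct a Aa _ e2) (cu a Aa _ eb) => y ht hu Ay s.
rewrite (le_trans (clip_lip _ _))//.
have -> : t a * u a s - t y * u y s = t a * (u a s - u y s) + (t a - t y) * u y s.
  by ring.
rewrite (le_trans (ler_normD _ _))// !normrM (ger0_norm (cube_ge0 _ _)).
have h1 : `|t a| * `|u a s - u y s| <= b * (e / 2 / b).
  by rewrite ler_pM ?hu// /b lerDl.
rewrite mulrCA divff ?gt_eqF// mulr1 in h1.
have h2 : `|t a - t y| * u y s <= `|t a - t y| by rewrite ler_piMr ?cube_le1.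
have := ltW (ht Ay); lra.
Qed.

Lemma within_inv A (t : Y -> R) : (forall a, A a -> 0 < t a) ->
  {within A, continuous t} -> {within A, continuous (fun y => (t y)^-1)}.
Proof.
move=> t0 /within_realP ct; apply/within_realP => a Aa e e0.
have ta := t0 a Aa.
have d0 : 0 < Num.min (t a / 2) (e * (t a * t a) / 4).
  by rewrite lt_min !divr_gt0 ?mulr_gt0.
apply: filterS (ct a Aa _ d0) => y + Ay => /(_ Ay).
rewrite lt_min => /andP[h1 h2].
have ty : t a / 2 < t y by move: h1; rewrite ltr_norml => /andP[? ?]; lra.
have ty0 := t0 y Ay.
have -> : (t a)^-1 - (t y)^-1 = (t y - t a) / (t a * t y).
  by field; rewrite !gt_eqF.
rewrite normrM normfV (gtr0_norm (mulr_gt0 ta ty0)) ltr_pdivrMr ?mulr_gt0//.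
rewrite distrC (lt_le_trans h2)//.
have : e * t a * (t a / 2) <= e * t a * t y by rewrite ler_wpM2l ?mulr_ge0 ?ltW.
have : 0 < e * t a * t a by rewrite !mulr_gt0.
lra.
Qed.

(** [v] is truncated coordinatewise to distance [r] from [c], then drawn towards [c] by the factor
    [1 - d]. With [d = 0] a point already within [r] of [c] does not move; with [d > 0] and [r > 0]
    the result is strictly within [r]. *)
Definition cpush S (c v : cube R S) (r d : R) : cube R S :=
  cube_of (fun s => c s + (1 - d) * Num.max (- r) (Num.min r (v s - c s))).

Lemma within_cpush S A (c v : Y -> cube R S) (r d : Y -> R) :
  (forall y, 0 <= r y <= 1) -> (forall y, 0 <= d y <= 1) ->
  {within A, continuous c} -> {within A, continuous v} ->
  {within A, continuous r} -> {within A, continuous d} ->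
  {within A, continuous (fun y => cpush (c y) (v y) (r y) (d y))}.
Proof.
move=> r01 d01 /within_cubeP cc /within_cubeP cv /within_realP cr /within_realP cd.
apply/within_cubeP => a Aa e e0; have e5 : 0 < e / 5 by rewrite divr_gt0.
have N : nbhs a [set y | A y -> `|r a - r y| < e / 5 /\ `|d a - d y| < e / 5].
  apply: filterS2 (cr a Aa _ e5) (cd a Aa _ e5) => y hr hd Ay.
  by split; [exact: hr|exact: hd].
apply: filterS3 (cc a Aa _ e5) (cv a Aa _ e5) N => y hc hv hrd Ay s.
have {}hc := hc Ay s; have {}hv := hv Ay s.
have [/ltW hr /ltW hd] := hrd Ay.
rewrite (le_trans (clip_lip _ _))//.
set m := Num.max _ _; set m' := Num.max (- r y) _.
have mm : `|m - m'| <= 3 * (e / 5).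
  by move: hc hv hr; rewrite /m /m' !ler_norml; case_real => *; lra.
have m'1 : `|m'| <= 1.
  by have := r01 y; rewrite /m' ler_norml; case_real => *; lra.
have -> : c a s + (1 - d a) * m - (c y s + (1 - d y) * m') =
   (c a s - c y s) + ((1 - d a) * (m - m') + (d y - d a) * m') by ring.
rewrite (le_trans (ler_normD _ _))//.
have h1 : `|(1 - d a) * (m - m')| <= `|m - m'|.
  rewrite normrM ler_piMl//; have := d01 a; rewrite ler_norml; lra.
have h2 : `|(d y - d a) * m'| <= `|d y - d a| by rewrite normrM ler_piMr.
have := ler_normD ((1 - d a) * (m - m')) ((d y - d a) * m').
rewrite (distrC (d y)) in h2; lra.
Qed.

Lemma cpush_dist S (c v : cube R S) r d : 0 <= r -> 0 <= d <= 1 ->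
  mdist (cpush c v r d) c <= (1 - d) * r.
Proof.
move=> r0 /andP[d0 d1].
have k0 : 0 <= 1 - d by rewrite subr_ge0.
apply: cube_dist_le => [|s]; first by rewrite mulr_ge0.
rewrite cube_ofE -[X in _ - X](clip_id (cube_itv c s)) (le_trans (clip_lip _ _))//.
rewrite addrC addKr normrM (ger0_norm k0) ler_wpM2l//.
by rewrite ler_norml; case_real => *; lra.
Qed.

Lemma cpush0 S (c v : cube R S) r : mdist v c <= r -> cpush c v r 0 = v.
Proof.
move=> vr; apply: cubeP => s; rewrite cube_ofE subr0 mul1r.
have := le_trans (cube_dist_ge v c s) vr; rewrite ler_norml => /andP[h1 h2].
by rewrite (min_idPr _) ?(max_idPr _)// addrC subrK clip_id// cube_itv.
Qed.

End CubeOperations.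

Lemma embeds_of_comp (X Y Z : topologicalType) (j : X -> Y) (k : Y -> Z) :
  continuous j -> continuous k -> embeds (k \o j) -> embeds j.
Proof.
move=> cj ck [kji kje]; split=> [x x' jx|x N]; first by apply: kji; rewrite /= jx.
split=> [/kje[V kV VN]|[V jV VN]]; last exact: (filterS VN (cj x V jV)).
by exists (k @^-1` V) => //; exact: ck.
Qed.

Lemma continuous_within_setT (Y Z : topologicalType) (f : Y -> Z) :
  {within setT, continuous f} -> continuous f.
Proof.
by move=> /withinP cf x N fN; apply: filterS (cf x I N fN) => y; exact.
Qed.

(** * From a corona to a resolution *)

Section CoronaNeighborhoods.
Local Open Scope ring_scope.
Variables (R : realType) (X : topologicalType) (J : Type) (K : set X).
Variable e : X -> cube R (option J).
Hypothesis ee : embeds e.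
Hypothesis cK : compact K.
Hypothesis eK : forall x, K x <-> e x None = 0.
Hypothesis aCK : ANE R (e @` ~` K).

Local Notation S := (option J).
Local Notation C := (cube R (S + S)).

Let base (w : C) : cube R S := creindex inl w.
Let fiber (w : C) : cube R S := creindex inr w.
Let height (w : C) : R := w (inl None).
Let center (w : C) : cube R S := cscale (height w)^-1 (fiber w).
Let phi (v : cube R S) : R := dist1 (e @` K) v.

(* The product of [cube R S] with the open cone over X \ K: the cone point
   [x, t] is encoded by the scaled vector [t e(x)] and its height t, which is
   stored as the coordinate [None] of the first factor. *)
Let cone : set C := [set w | (height w = 0 /\ forall s, fiber w s = 0) \/
  exists2 x, ~ K x & fiber w = cscale (height w) (e x)].

Let heightE w : base w None = height w. Proof. exact: creindexE. Qed.

Let height_itv w : 0 <= height w <= 1. Proof. exact: cube_itv. Qed.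

Let cone_gt0 w : cone w -> 0 < height w ->
  exists x, [/\ ~ K x, fiber w = cscale (height w) (e x) & center w = e x].
Proof.
move=> [[-> _]|[x Kx fw] h0]; first by rewrite ltxx.
exists x; split => //; rewrite /center fw cscaleK// h0.
by have /andP[] := height_itv w.
Qed.

Let cone_fiber_le w s : cone w -> fiber w s <= height w.
Proof.
move=> [[-> ->//]|[x _ ->]]; apply: cscale_le.
by have /andP[] := height_itv w.
Qed.

(** The coordinate [None] is 1-Lipschitz and vanishes on the image of [K]. Hence the cone component
    is small wherever the base is near [K]. *)
Let height_le_phi w : height w <= phi (base w).
Proof.
rewrite leNgt; apply/negP => h.
have [|_ [k Kk <-]] := dist1_ltP _ h; first by have /andP[] := height_itv w.
rewrite ltNge => /negP; apply; rewrite -heightE.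
have := cube_dist_ge (base w) (e k) None; rewrite ((eK k).1 Kk) subr0.
by rewrite ger0_norm// cube_ge0.
Qed.

Let within_base (Y : topologicalType) (A : set Y) (f : Y -> C) :
  {within A, continuous f} -> {within A, continuous (fun y => base (f y))}.
Proof. exact: within_creindex. Qed.

Let within_center (Y : topologicalType) (A : set Y) (f : Y -> C) :
  (forall a, A a -> 0 < height (f a)) ->
  {within A, continuous f} -> {within A, continuous (fun y => center (f y))}.
Proof.
move=> f0 cf; apply: within_cscale; last exact: within_creindex.
by apply: within_inv => //; exact: within_eval.
Qed.

Let within_phi (Y : topologicalType) (A : set Y) (g : Y -> cube R S) :
  {within A, continuous g} -> {within A, continuous (fun y => phi (g y))}.
Proof. exact: within_dist1_comp. Qed.

(** The base extends by the cube formula, the center by the ANE property of [X \ K], but only over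
    an open set [U]. The height is therefore extended anew so as to vanish off [U], where the cone
    point needs no center. *)
Let ANE_cone : ANE R cone.
Proof.
move=> Y O A f oO AO clA cf fA.
have cbase : {within A, continuous (fun y => base (f y))} by exact: within_creindex.
have [V cV VA] := cube_extension clA cbase.
have c0 D : {within D, continuous (fun=> 0 : R)}.
  by move=> T; apply: continuous_withinT; exact: cst_continuous.
pose O' := O `&` [set y | 0 < V y None].
have oO' : open O'.
  by apply: open_real_gt => //; exact: within_eval.
pose A' := A `&` [set y | 0 < V y None].
have A'h a : A' a -> 0 < height (f a) by move=> [Aa /=]; rewrite VA// heightE.
have [|||a A'a|U [G [oU [A'U UO'] cG GP Gf]]] :=
    aCK (Y := Y) (O := O') (A := A') (f := fun y => center (f y)) oO'.
- by move=> y [/AO Oy Vy]; split.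
- move=> y [cy [Oy Vy]]; split => //; apply: clA; split => //.
  by apply: closure_subset cy => z [].
- apply: within_cscale; last by apply: within_creindex; apply: within_sub cf => y [].
  apply: within_inv => //; apply: within_eval.
  by apply: within_sub cf => y [].
- have [x [nKx _ ->]] := cone_gt0 (fA a A'a.1) (A'h a A'a).
  by exists x.
(* On [A] outside [U] the height is already 0, so in the coordinate [None] this agrees with the zero
   map on the complement of [U]. Other coordinates need not agree, which is why [k] keeps that one
   only. *)
pose h y : cube R S := if pselect (A y) then V y else cube_of (fun=> 0).
pose B := A `|` (O `\` U).
have hAV a : A a -> h a = V a by rewrite /h; case: pselect.
have V0 a : A a -> ~ U a -> V a None = 0.
  move=> Aa nUa; apply/eqP; rewrite eq_le cube_ge0 andbT leNgt; apply/negP => V0.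
  by apply: nUa; apply: A'U.
have clB : closure B `&` O `<=` B.
  move=> y [+ Oy]; rewrite closureU => -[cy|cy]; first by left; apply: clA.
  right; split => // Uy; have [z [[_ nUz] Uz]] := cy U (open_nbhs_nbhs (conj oU Uy)).
  exact: nUz.
pose k (u : cube R S) : cube R unit := creindex (fun=> None) u.
have ch : {within B, continuous (fun y => k (h y))}.
  apply: within_setU.
  - by move=> y [cy [Oy _]]; exact: clA.
  - move=> y [cy Ay]; split; first exact: AO.
    move=> Uy; have [z [[_ nUz] Uz]] := cy U (open_nbhs_nbhs (conj oU Uy)).
    exact: nUz.
  - apply: (@within_eq _ _ _ (fun y => k (V y))) => [a Aa|]; first by rewrite hAV.
    by apply: within_creindex; exact: within_sub cV.
  - apply: (@within_eq _ _ _ (fun=> cube_of (fun=> 0))) => [a [Oa nUa]|].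
      apply: cubeP => s; rewrite creindexE /h; case: pselect => // Aa.
      by rewrite V0//= clip_id// lexx ler01.
    by apply: continuous_withinT; exact: cst_continuous.
have [H cH HB] := cube_extension clB ch.
have HA a : A a -> H a tt = height (f a).
  by move=> Aa; rewrite HB; [rewrite creindexE hAV// VA// heightE|left].
have HU y : O y -> ~ U y -> H y tt = 0.
  move=> Oy nUy; rewrite HB; last by right.
  rewrite creindexE /h; case: pselect => Ay; first exact: V0.
  by rewrite /= clip_id// lexx ler01.
(* The height is read off from the base, so the coordinate [None] of [V] has to be replaced by the
   new height. *)
pose H' y : cube R S := consc (H y tt) (creindex Some (V y)).
have H'None y : H' y None = H y tt by rewrite consc_None// cube_itv.
have H'A a : A a -> H' a = base (f a).
  move=> Aa; apply: cubeP => -[s|]; last by rewrite H'None HA// heightE.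
  by rewrite consc_Some creindexE VA.
pose F y := cpair (H' y) (cscale (H y tt) (G y)).
have bF y : base (F y) = H' y by exact: cpair_inl.
have fF y : fiber (F y) = cscale (H y tt) (G y) by exact: cpair_inr.
have hF y : height (F y) = H y tt by rewrite -heightE bF H'None.
have cH' : {within O, continuous (fun y => H y tt)} by exact: within_eval.
exists O, F; split => //; first by split.
- apply: within_cpair; first by apply: within_consc => //; exact: within_creindex.
  (* Off [U] the values of [G] are uncontrolled, but [H] vanishes there and bounds the scaled vector
     nearby. *)
  apply/within_cubeP => y Oy d d0; have [Uy|nUy] := pselect (U y).
    have UO y' : U y' -> O y' by move=> /UO'[].
    have /within_cubeP : {within U, continuous (fun y => cscale (H y tt) (G y))}.
      by apply: within_cscale => //; exact: within_sub cH'.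
    move=> /(_ y Uy d d0); apply: filterS2 (open_nbhs_nbhs (conj oU Uy)) => z Uz hz _.
    exact: hz.
  have /within_realP/(_ y Oy d d0) := cH'; apply: filterS => z hz Oz s.
  move: (hz Oz); rewrite HU// cscale0 !sub0r !normrN !ger0_norm ?cube_ge0//.
  by move/ltW; apply: le_trans; apply: cscale_le; exact: cube_ge0.
- move=> y Oy; have [Uy|nUy] := pselect (U y); last first.
    by left; rewrite fF hF HU//; split => // s; rewrite cscale0.
  right; have [x nKx Gx] := GP y Uy; exists x => //.
  by rewrite fF hF Gx.
- move=> a Aa; rewrite -[RHS]cpair_eta; congr cpair; first exact: H'A.
  rewrite HA//.
  have [h0|h0] := ltP 0 (height (f a)).
    have Aa' : A' a by split => //=; rewrite VA// heightE.
    have [x [_ fx cx]] := cone_gt0 (fA a Aa) h0.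
    by rewrite Gf// cx -fx.
  have {}h0 : height (f a) = 0 by apply/eqP; rewrite eq_le h0; have /andP[] := height_itv (f a).
  apply: cubeP => s; rewrite h0 cscale0.
  apply/eqP; rewrite eq_le cube_ge0/= -[leRHS]h0; apply: cone_fiber_le; exact: fA.
Qed.


(** Positive exactly for [p < 2 * c]. It is 1-Lipschitz in [p], and at most 1 for [p >= 0] and
    [c <= 1], as [within_cpush] demands. *)
Let radius (c p : R) : R := Num.max 0 ((2 * c - p) / 4).

Let radius_ge0 c p : 0 <= radius c p. Proof. by rewrite /radius le_max lexx. Qed.

Let within_radius (Y : topologicalType) (A : set Y) (g : Y -> cube R S) c :
  {within A, continuous g} ->
  {within A, continuous (fun y => radius c (phi (g y)))}.
Proof.
move=> cg; apply: (within_lip (g := radius c)) (within_phi cg) => x y.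
by rewrite /radius; case_real => *; lra.
Qed.

Let near_center c : set C :=
  [set w | 0 < height w /\ mdist (base w) (center w) < radius c (phi (center w))].

(* Where [phi (center w) >= 2 c] the radius vanishes, and only the points of X
   are left. *)
Let nbhd c : set C := cone `&` [set w | phi (base w) < c \/
  near_center c w \/ (0 < height w /\ base w = center w)].

Let inner c : set C := [set w | phi (base w) < c] `|` near_center c.

(** The last condition rules out the first alternative in [nbhd], so every point of [nbhd c] in
    [outer c] is within [radius] of its center. *)
Let outer c : set C := [set w |
  [/\ 0 < height w, 3 / 2 * c < phi (center w) & c < phi (base w)]].

Let within_id (A : set C) : {within A, continuous (fun w : C => w)}.
Proof. by apply: continuous_withinT => w; exact: cvg_id. Qed.

Let within_cst (Y : topologicalType) (A : set Y) (c : R) :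
  {within A, continuous (fun=> c)}.
Proof. by apply: continuous_withinT; exact: cst_continuous. Qed.

Let upper : set C := setT `&` [set w | 0 < height w].

Let open_upper : open upper.
Proof. by apply: open_real_gt; [exact: openT|exact: within_cst|exact: within_coord]. Qed.

Let within_center_upper : {within upper, continuous center}.
Proof. by apply: within_center => [w []|]; last exact: within_id. Qed.

Let within_phi_base A : {within A, continuous (fun w => phi (base w))}.
Proof. by apply: within_phi; apply: within_base; exact: within_id. Qed.

Let open_inner c : open (inner c).
Proof.
apply: openU.
  rewrite -[X in open X]setTI; apply: open_real_gt; first exact: openT.
    exact: within_phi_base.
  exact: within_cst.
have -> : near_center c = upper `&`
    [set w | mdist (base w) (center w) < radius c (phi (center w))].
  by apply/seteqP; split=> [w [h1 h2]|w [[_ h1] h2]].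
apply: open_real_gt => //; last exact: within_radius within_center_upper.
apply: within_mdist; last exact: within_center_upper.
by apply: within_base; exact: within_id.
Qed.

Let open_outer c : open (outer c).
Proof.
have -> : outer c = (upper `&` [set w | 3 / 2 * c < phi (center w)]) `&`
    [set w | c < phi (base w)].
  by apply/seteqP; split=> [w [h1 h2 h3]|w [[[_ h1] h2] h3]].
apply: open_real_gt; last exact: within_phi_base.
  apply: open_real_gt; first exact: open_upper.
    exact: within_cst.
  exact: within_phi within_center_upper.
exact: within_cst.
Qed.

Let cover c : 0 < c -> nbhd c `<=` inner c `|` outer c.
Proof.
move=> c0 w [_ [h|[h|[h0 bc]]]]; [by left; left|by left; right|].
have [h|h] := ltP (phi (center w)) (2 * c).
  left; right; split => //; rewrite bc mdistxx /radius lt_max; apply/orP; right.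
  by rewrite divr_gt0// subr_gt0.
by right; split; rewrite ?bc//; lra.
Qed.

Let ANE_inner c : ANE R (nbhd c `&` inner c).
Proof.
have -> : nbhd c `&` inner c = cone `&` inner c.
  apply/seteqP; split=> [w [[Tw _] iw]//|w [Tw iw]]; split => //; split => //.
  by case: iw => h; [left|right; left].
exact: ANE_setI_open (@open_inner c) ANE_cone.
Qed.

(** Center and base are extended independently, and the base is then pushed to within [radius] of
    the center. The push is trivial on [A], where [d] is 0; off [A] it ends in the open tube, or at
    the center itself where the radius vanishes. *)
Let ANE_outer c : 0 < c -> c <= 1 -> ANE R (nbhd c `&` outer c).
Proof.
move=> c0 c1 Y O A f oO AO clA cf fA.
have fA_close a : A a -> mdist (base (f a)) (center (f a)) <= radius c (phi (center (f a))).
  move=> Aa; have [[_ + [h1 h2 h3]]] := fA a Aa.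
  case=> [h|[[_ /ltW//]|[_ ->]]]; last by rewrite mdistxx.
  by move: h3; rewrite ltNge ltW.
have fAh a : A a -> 0 < height (f a) by move=> /fA[_ []].
have [V cV VA] := cube_extension clA (within_base cf).
have [||U [G [oU [AU UO] cG GP Gf]]] :=
    aCK (f := fun y => center (f y)) oO AO clA.
- exact: within_center.
- move=> a Aa; have [[Ta _] _] := fA a Aa.
  by have [x [nKx _ ->]] := cone_gt0 Ta (fAh a Aa); exists x.
pose d y := dist1 A y / 2.
have d01 y : 0 <= d y <= 1.
  by have := dist1_ge0 A y; have := dist1_le1 A y; rewrite /d; lra.
have r01 p : 0 <= p -> 0 <= radius c p <= 1.
  by move=> p0; rewrite radius_ge0/= /radius; case_real => *; lra.
pose V' y := cpush (G y) (V y) (radius c (phi (G y))) (d y).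
have cV' : {within U, continuous V'}.
  apply: within_cpush => //.
  - by move=> y; apply: r01; exact: dist1_ge0.
  - exact: within_sub cV.
  - exact: within_radius.
  - apply: (within_lip (f := dist1 A) (g := fun x => x / 2)) => [x y|].
      by case_real => *; lra.
    exact: within_dist1.
pose U1 := (U `&` [set y | 3 / 2 * c < phi (G y)]) `&` [set y | 0 < V' y None].
pose U2 := U1 `&` [set y | c < phi (V' y)].
have U1U : U1 `<=` U by move=> y [[]].
have oU1 : open U1.
  apply: open_real_gt; first by apply: open_real_gt => //; exact: within_phi.
    exact: within_cst.
  by apply: within_eval; apply: within_sub cV' => y [].
have oU2 : open U2.
  apply: open_real_gt => //.
  by apply: within_phi; exact: within_sub cV'.
have V'A a : A a -> V' a = base (f a).
  move=> Aa; rewrite /V' /d dist1_in// mul0r cpush0 ?VA//.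
  by rewrite Gf//; exact: fA_close.
pose F y := cpair (V' y) (cscale (V' y None) (G y)).
have bF y : base (F y) = V' y by exact: cpair_inl.
have fF y : fiber (F y) = cscale (V' y None) (G y) by exact: cpair_inr.
have hF y : height (F y) = V' y None by rewrite -heightE bF.
have cF y : 0 < V' y None -> center (F y) = G y.
  by move=> h; rewrite /center fF hF cscaleK// h cube_le1.
have FA a : A a -> F a = f a.
  move=> Aa; rewrite -[RHS]cpair_eta; congr cpair; first exact: V'A.
  rewrite V'A// heightE Gf//.
  have [[Ta _] _] := fA a Aa.
  by have [x [_ fx cx]] := cone_gt0 Ta (fAh a Aa); rewrite cx -fx.
exists U2, F; split => //.
- split=> [a Aa|y [/U1U/UO]//].
  have [_ [h1 h2 h3]] := fA a Aa.
  split; last by rewrite /mkset V'A.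
  by split; [split; [exact: AU|rewrite /mkset Gf]|rewrite /mkset V'A// heightE].
- apply: within_cpair; first by apply: within_sub cV' => y [/U1U].
  apply: within_cscale; last by apply: within_sub cG => y [/U1U].
  by apply: within_eval; apply: within_sub cV' => y [/U1U].
- move=> y [[[Uy h1] h2] h3]; rewrite /mkset in h1 h2 h3.
  have [Ay|nAy] := pselect (A y); first by rewrite FA//; exact: fA.
  split; last by split; rewrite ?hF ?cF ?bF.
  split.
    by right; have [x nKx Gx] := GP y Uy; exists x => //; rewrite fF hF Gx.
  right; rewrite /near_center /mkset hF cF// bF.
  have d0 : 0 < d y.
    rewrite divr_gt0//; apply/dist1_gt0P => cy; apply: nAy; apply: clA; split => //.
    exact: UO.
  have := cpush_dist (G y) (V y) (radius_ge0 c (phi (G y))) (d01 y).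
  rewrite -/(V' y) => h4.
  have [r0|r0] := ltP 0 (radius c (phi (G y))).
    left; split => //; apply: le_lt_trans h4 _.
    by rewrite -[ltRHS]mul1r ltr_pM2r//; lra.
  right; split => //; apply: mdist_positivity; apply/eqP.
  rewrite eq_le mdist_ge0 andbT (le_trans h4)// mulr_ge0_le0//.
  by have /andP[_] := d01 y; lra.
Qed.

Let ANE_nbhd c : 0 < c -> c <= 1 -> ANE R (nbhd c).
Proof.
move=> c0 c1; apply: (ANE_union2 (@open_inner c) (@open_outer c) (cover c0)).
  exact: ANE_inner.
exact: ANE_outer.
Qed.

Let nbhd_sub c c' : c <= c' -> nbhd c `<=` nbhd c'.
Proof.
move=> cc' w [Tw h]; split => //; case: h => [h|[[h0 h]|h]].
- by left; exact: lt_le_trans cc'.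
- right; left; split => //; apply: lt_le_trans h _.
  by rewrite /radius; case_real => *; lra.
- by right; right.
Qed.

Let iota x : C := cpair (e x) (cscale (e x None) (e x)).

Let base_iota x : base (iota x) = e x. Proof. exact: cpair_inl. Qed.

Let fiber_iota x : fiber (iota x) = cscale (e x None) (e x).
Proof. exact: cpair_inr. Qed.

Let height_iota x : height (iota x) = e x None.
Proof. by rewrite -heightE base_iota. Qed.

Let embeds_iota : embeds iota.
Proof.
have ce : {within setT, continuous e}.
  by apply: continuous_withinT; exact: embeds_continuous.
apply: (@embeds_of_comp _ _ _ iota base).
- apply: continuous_within_setT; apply: within_cpair => //.
  by apply: within_cscale => //; exact: within_eval.
- by apply: continuous_within_setT; apply: within_base; exact: within_id.
- by have -> : base \o iota = e by apply/funext.
Qed.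

Let iota_nbhd c x : 0 < c -> nbhd c (iota x).
Proof.
move=> c0; have [Kx|nKx] := pselect (K x).
  split; last by left; rewrite /= base_iota /phi dist1_in//; exists x.
  left; rewrite height_iota ((eK x).1 Kx); split => // s.
  by rewrite fiber_iota ((eK x).1 Kx) cscale0.
have h0 : 0 < height (iota x).
  rewrite height_iota lt_neqAle cube_ge0 andbT; apply/eqP => h.
  by apply: nKx; apply/eK.
split; first by right; exists x => //; rewrite fiber_iota height_iota.
right; right; split => //; rewrite /center fiber_iota height_iota base_iota.
by rewrite cscaleK// -height_iota h0; have /andP[] := height_itv (iota x).
Qed.

(* Away from K the sets [nbhd c] coincide with X, so compactness of K is enough. *)
Let nbhd_shrink (W : set C) : open W -> range iota `<=` W ->
  exists n, nbhd n.+1%:R^-1 `<=` W.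
Proof.
move=> oW iW.
(* Compactness of [K] gives one radius that works at all its points. *)
have [r r0 rW] : exists2 r, 0 < r & forall k, K k -> forall w, mdist (iota k) w < r -> W w.
  have := (compact_near_coveringP K).1 cK nat \oo
    (fun n k => forall w, mdist (iota k) w < n.+1%:R^-1 -> W w) _.
  case=> [k Kk|n _ hn]; last first.
    exists n.+1%:R^-1; first by rewrite invr_gt0.
    by move=> k Kk w kw; exact: (hn n (leqnn n) k Kk w kw).
  have /nbhs_mdist[d d0 dW] : nbhs (iota k) W.
    by apply: open_nbhs_nbhs; split => //; apply: iW; exists k.
  have d2 : 0 < d / 2 by rewrite divr_gt0.
  have [n hn] := inv_succ_small d2.
  exists ([set k' | mdist (iota k) (iota k') < d / 2], [set m | (n <= m)%N]).
    split => /=; last by exists n.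
    exact: (embeds_continuous embeds_iota (near_mdist (iota k) d2)).
  move=> [k' m] [/= kk' nm] w kw; apply: dW.
  have := hn m nm; have := metric_triangle (iota k) (iota k') w.
  by move: kw; move: m.+1%:R^-1 => z; lra.
have r4 : 0 < Num.min 1 r / 4 by rewrite divr_gt0// lt_min ltr01.
have [n hn] := inv_succ_small r4.
exists n => w [Tw]; have := hn n (leqnn n).
have : 0 < n.+1%:R^-1 :> R by rewrite invr_gt0.
move: n.+1%:R^-1 => c c0 cr.
(* The base is within [3 * c] of some [e k]. The fiber of [iota k] is 0, while that of [w] is
   bounded by its height, hence by [phi (base w)]. The choice of [c] makes [3 * c] smaller than [r],
   and at most 1 as [dist1_ltP] requires. *)
have close : phi (base w) < 3 * c -> W w.
  move=> pc.
  have c1 : 3 * c <= 1 by move: cr; case_real => *; lra.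
  have [_ [k Kk <-] bk] := dist1_ltP c1 pc.
  apply: (rW k Kk); apply: (@le_lt_trans _ _ (3 * c)); last first.
    by move: cr; case_real => *; lra.
  apply: cube_dist_le => [|[s|s]]; first by lra.
    have -> : iota k (inl s) = e k s by rewrite -base_iota creindexE.
    have -> : w (inl s) = base w s by rewrite creindexE.
    by rewrite distrC (le_trans (cube_dist_ge _ _ _))// ltW.
  have -> : iota k (inr s) = 0.
    by rewrite cpairE ((eK k).1 Kk) cscale0.
  have -> : w (inr s) = fiber w s by rewrite creindexE.
  rewrite sub0r normrN ger0_norm ?cube_ge0//.
  rewrite (le_trans (cone_fiber_le _ Tw))// (le_trans (height_le_phi w))//.
  exact: ltW.
case=> [h|[[h0 h]|[h0 bc]]].
- by apply: close; apply: lt_trans h _; lra.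
- apply: close; have := dist1_lip (e @` K) (base w) (center w); rewrite -/(phi _) -/(phi _).
  have := dist1_ge0 (e @` K) (center w); rewrite -/(phi _).
  by move: h; rewrite /radius; case_real => *; lra.
- apply: iW; have [x [nKx fx cx]] := cone_gt0 Tw h0; exists x => //.
  rewrite -[RHS]cpair_eta -/(base w) -/(fiber w) bc cx /iota fx; congr (cpair _ (cscale _ _)).
  by rewrite -heightE bc cx.
Qed.

Let radii n : R := n.+1%:R^-1.

Let radii_gt0 n : 0 < radii n. Proof. by rewrite invr_gt0. Qed.

Let radii_le1 n : radii n <= 1. Proof. by rewrite invf_le1// ler1n. Qed.

Let radii_le m n : (n <= m)%N -> radii m <= radii n.
Proof. by move=> nm; rewrite lef_pV2 ?posrE// ler_nat. Qed.

Let stages n : topologicalType := (nbhd (radii n) : Type).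

Let inclusion m n (nm : (n <= m)%N) (w : stages m) : stages n :=
  exist _ (\val w) (mem_set (nbhd_sub (radii_le nm) (set_mem (valP w)))).

Let embeds_inclusion m n (nm : (n <= m)%N) : embeds (@inclusion m n nm).
Proof.
have ev := @embeds_val C (nbhd (radii m)).
apply: (@embeds_of_comp _ _ _ _ (\val : stages n -> C)) => //.
  by apply: (embeds_lift (@embeds_val _ _)); exact: embeds_continuous ev.
exact: embeds_continuous (@embeds_val _ _).
Qed.

Let corona_sequence : inverse_sequence.
Proof.
refine (@InverseSequence stages inclusion _ _ _).
- by move=> m n nm; exact: embeds_continuous.
- by move=> n nn x; exact: val_inj.
- by move=> m n k nm kn x; exact: val_inj.
Defined.

Let to_stage n x : stages n := exist _ (iota x) (mem_set (iota_nbhd x (radii_gt0 n))).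

Let stage_B1 n (U : set (stages n)) : set_nbhs (range (to_stage n)) U ->
  exists m (nm : (n <= m)%N), range (@inclusion m n nm) `<=` U.
Proof.
move=> nU; pose W := [set w | exists2 V, open_nbhs w V &
  forall w' : stages n, V (\val w') -> U w'].
have oW : open W.
  rewrite openE => w [V [oV Vw] VU]; apply: filterS (open_nbhs_nbhs (conj oV Vw)).
  by move=> w' Vw'; exists V.
have iW : range iota `<=` W.
  move=> _ [x _ <-].
  have /((@embeds_val _ _).2 _ _).1[V] := nU (to_stage n x) (ex_intro2 _ _ x I erefl).
  by rewrite nbhsE => -[V' oV' V'V] VU; exists V' => // w' /V'V /VU.
have [k kW] := nbhd_shrink oW iW.
exists (maxn n k), (leq_maxl n k) => _ [w _ <-].
have [V [_ Vw] VU] := kW _ (nbhd_sub (radii_le (leq_maxr n k)) (set_mem (valP w))).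
exact: VU.
Qed.

Let stage_B2 (D : set (set X)) : open_cover D ->
  exists n (D' : set (set (stages n))),
    open_cover D' /\ refines [set to_stage n @^-1` V | V in D'] D.
Proof.
move=> [oD DT].
pose D0 := [set V : set C | open V /\ exists2 U, D U & forall x, V (iota x) -> U x].
have oW : open (\bigcup_(V in D0) V) by apply: bigcup_open => V [].
have iW : range iota `<=` \bigcup_(V in D0) V.
  move=> _ [x _ <-]; have [U DU Ux] : (\bigcup_(U in D) U) x by rewrite DT.
  have /(embeds_iota.2 x)[V] := open_nbhs_nbhs (conj (oD U DU) Ux).
  rewrite nbhsE => -[V' [oV' V'x] V'V] VU; exists V' => //.
  by split => //; exists U => // x' /V'V /VU.
have [n nW] := nbhd_shrink oW iW.
exists n, [set \val @^-1` V | V in D0]; split; last first.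
  move=> _ [_ [V [oV [U DU VU]] <-] <-]; exists U => // x; exact: VU.
split=> [_ [V [oV _] <-]|].
  by apply: open_comp => // w _; exact: (embeds_continuous (@embeds_val _ _)).
rewrite -subTset => w _.
have [V DV Vw] := nW _ (set_mem (valP w)).
by exists (\val @^-1` V) => //; exists V.
Qed.

Let stage_intersection w : (forall n, nbhd (radii n) w) -> exists x, iota x = w.
Proof.
move=> Nw; apply: contrapT => H.
have cl : closed [set w] by apply: compact_closed; [exact: metric_hausdorff|exact: compact_set1].
have [|n nW] := nbhd_shrink (closed_openC cl).
  by move=> _ [x _ <-] xw; apply: H; exists x.
exact: (nW w (Nw n)).
Qed.

Let stage_limit : @is_inverse_limit corona_sequence X to_stage.
Proof.
have thr x : threads corona_sequence (fun n => to_stage n x).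
  by move=> m n nm; exact: val_inj.
pose h x : threads corona_sequence :=
  exist (fun f => f \in threads corona_sequence) _ (mem_set (thr x)).
exists h => //; split.
  apply: (embeds_lift (@embeds_val _ _)).
  apply: (@continuous_prod_topology _ stages) => n.
  apply: (embeds_lift (@embeds_val _ _)); exact: embeds_continuous embeds_iota.
(* The bonding maps are inclusions, so a thread is a single point lying in every stage. *)
have gP (t : threads corona_sequence) : exists x, iota x = \val (\val t 0%N).
  apply: stage_intersection => n; have /set_mem/(_ n 0%N (leq0n n)) := valP t.
  by move=> <-; exact: (set_mem (valP (\val t n))).
pose g t := sval (cid (gP t)).
have gE t : iota (g t) = \val (\val t 0%N) by rewrite /g; case: cid.
exists g; split.
- apply: (embeds_lift embeds_iota).
  have -> : iota \o g = (fun w : stages 0%N => \val w) \o (@proj nat stages 0%N \o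
      (fun t : threads corona_sequence => \val t)).
    by apply/funext => t; rewrite /= gE.
  have c1 := embeds_continuous (@embeds_val _ (threads corona_sequence)).
  have c2 := embeds_continuous (@embeds_val _ (nbhd (radii 0))).
  move=> t.
  exact: (continuous_comp (continuous_comp (c1 t) (@proj_continuous _ stages 0%N _)) (c2 _)).
- by move=> x; apply: embeds_iota.1; rewrite gE.
- move=> t; apply: val_inj => /=; apply/functional_extensionality_dep => n.
  apply: val_inj => /=; rewrite gE.
  by have /set_mem/(_ n 0%N (leq0n n)) := valP t => <-.
Qed.

Lemma corona_resolution : metrizable R X ->
  exists (T : inverse_sequence) (q : forall n : nat, X -> T n),
     [/\ is_resolution R q, forall i : nat, ANR R (T i) &
         forall (i j : nat) (le_ji : (j <= i)%N), embedding (@bond T i j le_ji)].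
Proof.
move=> mX.
have mC : metrizable R C.
  apply/metrizableP; exists C, id; split=> // w N; split=> [wN|[V wV VN]]; first by exists N.
  exact: (filterS VN wV).
exists corona_sequence, to_stage; split.
- split.
  + by move=> n; exact: embeds_metrizable (@embeds_val _ _) mC.
  + exact: stage_limit.
  + by move=> n U; exact: stage_B1.
  + by move=> D; exact: stage_B2.
- move=> n; apply: (ANE_set_ANR mC).
  by apply: ANE_nbhd; [exact: radii_gt0|exact: radii_le1].
- by move=> i j ji; apply: embeds_embedding; exact: embeds_inclusion.
Qed.

End CoronaNeighborhoods.

(** * The equivalence of the three conditions *)

Section Equivalence.
Local Open Scope ring_scope.
Variables (R : realType) (X : topologicalType).

Lemma coronated_resolution : coronated_ANR R X ->
  exists (S : inverse_sequence) (q : forall n : nat, X -> S n),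
     [/\ is_resolution R q, forall i : nat, ANR R (S i) &
         forall (i j : nat) (le_ji : (j <= i)%N), embedding (@bond S i j le_ji)].
Proof.
move=> [mX [K cK aK]]; have [e0 e0e] := kuratowski mX.
(* The added coordinate is the distance to [K]; its zero set is exactly [K] because the image of [K]
   is compact, hence closed. *)
pose e x : cube R (option X) := consc (dist1 (e0 @` K) (e0 x)) (e0 x).
have eNone x : e x None = dist1 (e0 @` K) (e0 x).
  by rewrite consc_None// dist1_ge0 dist1_le1.
have ce0 : {within setT, continuous e0}.
  by apply: continuous_withinT; exact: embeds_continuous.
have ee : embeds e.
  apply: (@embeds_of_comp _ _ _ e (creindex Some)).
  - apply: continuous_within_setT; apply: within_consc => //.
    exact: within_dist1_comp.
  - apply: continuous_within_setT; apply: within_creindex.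
    by apply: continuous_withinT => u; exact: cvg_id.
  - have -> // : creindex Some \o e = e0.
    apply/funext => x; apply: cubeP => s.
    by rewrite [LHS]creindexE consc_Some.
have eK x : K x <-> e x None = 0.
  rewrite eNone; split=> [Kx|d0]; first by rewrite dist1_in//; exists x.
  have : closed (e0 @` K).
    apply: compact_closed; first exact: metric_hausdorff.
    by apply: continuous_compact => //; exact: within_sub ce0.
  move=> cl; have : (e0 @` K) (e0 x).
    by apply: cl; apply: contrapT => /dist1_gt0P; rewrite d0 ltxx.
  by move=> [k Kk /e0e.1 <-].
apply: (corona_resolution ee cK eK) => //.
rewrite -[~` K]range_val image_comp.
by apply: ANR_ANE aK _; exact: embeds_set.
Qed.

Lemma embedding_range_ANR (Y Z : topologicalType) (f : Y -> Z) :
  metrizable R Z -> ANR R Y -> embedding f -> ANR R (range f : Type).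
Proof.
move=> mZ aY /embedding_embeds fe.
by apply: ANE_set_ANR mZ _; exact: ANR_ANE.
Qed.

End Equivalence.

Theorem theorem2 (R : realType) (X : topologicalType) (hX : metrizable R X) :
  (coronated_ANR R X <->
   exists (S : inverse_sequence) (q : forall n : nat, X -> S n),
     is_resolution R q /\
     forall (i j : nat) (le_ji : (j <= i)%N),
       ANR R (range (@bond S i j le_ji) : Type))
  /\
  (coronated_ANR R X <->
   exists (S : inverse_sequence) (q : forall n : nat, X -> S n),
     [/\ is_resolution R q,
         forall i : nat, ANR R (S i) &
         forall (i j : nat) (le_ji : (j <= i)%N),
           embedding (@bond S i j le_ji)]).
Proof.
(* Condition (3) implies (2): the image of an ANR under an embedding is a copy of it. *)
have weaken (S : inverse_sequence) (q : forall n : nat, X -> S n) :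
    is_resolution R q -> (forall i, ANR R (S i)) ->
    (forall (i j : nat) (le_ji : (j <= i)%N), embedding (@bond S i j le_ji)) ->
    forall (i j : nat) (le_ji : (j <= i)%N), ANR R (range (@bond S i j le_ji) : Type).
  move=> rq aS eS i j ji; apply: embedding_range_ANR => //.
  exact: (resolution_metrizable rq).
split; split.
- move=> /coronated_resolution[S [q [rq aS eS]]].
  by exists S, q; split => //; exact: weaken rq aS eS.
- by move=> [S [q [rq aS]]]; exact: resolution_coronated rq aS.
- exact: coronated_resolution.
- move=> [S [q [rq aS eS]]].
  exact: (resolution_coronated hX rq (weaken _ _ rq aS eS)).
Qed.
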